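(* Let $R>0$ and $u$ be a subminimizer of $\mathcal{F}$ in $B_{2R}$. Then $$\sup_{B_R}u\le C\left(R+\frac{1}{|B_{2R}|}\int_{B_{2R}}u_+(x)\,dx\right),$$ for some constant $C>0$ depending only on $n$, $s$, and $g$.
   Context: $n\ge1$ is an integer, $s\in(0,1)$, and $g:\mathbb{R}\to(0,1]$ is an even continuous function with $\int_{\mathbb{R}}g(t)|t|\,dt<\infty$. Set $G(t):=\int_0^t g(\tau)\,d\tau$ and $\mathcal{G}(t):=\int_0^t G(\tau)\,d\tau$. $B_\varrho$ is the ball of radius $\varrho$ centered at the origin of $\mathbb{R}^n$, $u_+:=\max\{u,0\}$, and $\sup$ denotes the essential supremum. For $\Omega\subseteq\mathbb{R}^n$ bounded open with Lipschitz boundary, $Q(\Omega):=\mathbb{R}^{2n}\setminus(\mathbb{R}^n\setminus\Omega)^2$; $\mathcal{W}^s(\Omega)$ is the set of measurable $u:\mathbb{R}^n\to\mathbb{R}$ with $u|_\Omega\in L^1(\Omega)$ and $\int_\Omega\int_\Omega\frac{|u(x)-u(y)|}{|x-y|^{n+s}}\,dx\,dy<\infty$. A measurable $u:\mathbb{R}^n\to\mathbb{R}$ is a subminimizer of $\mathcal{F}$ in $\Omega$ if $u\in\mathcal{W}^s(\Omega)$ and $$\iint_{Q(\Omega)}\left\{\mathcal{G}\left(\frac{u(x)-u(y)}{|x-y|}\right)-\mathcal{G}\left(\frac{v(x)-v(y)}{|x-y|}\right)\right\}\frac{dx\,dy}{|x-y|^{n-1+s}}\le0$$ for every $v\in\mathcal{W}^s(\Omega)$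 such that $v=u$ a.e. in $\mathbb{R}^n\setminus\Omega$ and $v\le u$ a.e. in $\Omega$. (The integral converges absolutely for such $u,v$.) *)

(* Defs.v *)
From HB Require Import structures.
From mathcomp Require Import all_boot all_order all_algebra.
From mathcomp Require Import all_classical all_reals all_analysis.
From mathcomp Require Import ess_sup_inf.

Set Implicit Arguments.
Unset Strict Implicit.
Unset Printing Implicit Defensive.

Import Order.TTheory GRing.Theory Num.Theory.
Import numFieldNormedType.Exports.

Local Open Scope classical_set_scope.
Local Open Scope ring_scope.

Section borel_lebesgue.
Context {R : realType}.

Definition tcons n (z : R * n.-tuple R) : n.+1.-tuple R :=
  [tuple of z.1 :: z.2].

Lemma measurable_tcons n : measurable_fun [set: R * n.-tuple R] (@tcons n).
Proof. exact: measurable_cons. Qed.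

Section step.
Variables (n : nat) (m : {sigma_finite_measure set (n.-tuple R) -> \bar R}).

Definition lebesgue_step : set (n.+1.-tuple R) -> \bar R :=
  pushforward (@lebesgue_measure R \x m)%E (@tcons n).

Let step0 : lebesgue_step set0 = 0%E.
Proof. by rewrite /lebesgue_step /pushforward preimage_set0 measure0. Qed.

Let step_ge0 A : (0 <= lebesgue_step A)%E.
Proof. by rewrite /lebesgue_step /pushforward; exact: measure_ge0. Qed.

Let step_sigma_additive : semi_sigma_additive lebesgue_step.
Proof.
move=> F mF tF mUF; rewrite /lebesgue_step /pushforward preimage_bigcup.
apply: measure_semi_sigma_additive.
- by move=> k; rewrite -[X in measurable X]setTI; exact: measurable_tcons.
- apply/trivIsetP => /= i j _ _ ij; rewrite -preimage_setI.
  by move/trivIsetP : tF => /(_ _ _ _ _ ij) ->//; rewrite preimage_set0.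
- by rewrite -preimage_bigcup -[X in measurable X]setTI; exact: measurable_tcons.
Qed.

HB.instance Definition _ := isMeasure.Build _ _ _ lebesgue_step
  step0 step_ge0 step_sigma_additive.

Let step_sigma_finite : sigma_finite setT lebesgue_step.
Proof.
have [F TF Ffin] : sigma_finite setT (@lebesgue_measure R \x m)%E.
  have /sigma_finiteP[F [TF ndF Foo]] := sigma_finiteT (@lebesgue_measure R).
  have /sigma_finiteP[G [TG ndG Goo]] := sigma_finiteT m.
  exists (fun k => F k `*` G k) => [|k].
    rewrite -setXTT TF TG predeqE => -[x y]; split => [|[k _ []/= ? ?]].
      move=> [/= [i _ Fix] [k _ Gky]]; exists (maxn i k) => //; split.
        by move: x Fix; exact/subsetPset/ndF/leq_maxl.
      by move: y Gky; exact/subsetPset/ndG/leq_maxr.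
    by split; exists k.
  have [? ?] := Foo k; have [? ?] := Goo k.
  split; first exact: measurableX.
  by rewrite product_measure1E// lte_mul_pinfty// ge0_fin_numE.
pose uncons (t : n.+1.-tuple R) : R * n.-tuple R :=
  (tnth t ord0, [tuple of behead t]).
have mu : measurable_fun setT uncons.
  apply/measurable_fun_pairP; split; first exact: measurable_tnth.
  exact: measurable_behead.
have tK : cancel (@tcons n) uncons.
  by move=> [a t]; congr pair; apply: val_inj.
exists (fun k => uncons @^-1` F k) => [|k].
  by rewrite -preimage_bigcup -TF preimage_setT.
have [mF Foo] := Ffin k; split; first by rewrite -[X in measurable X]setTI; exact: mu.
rewrite /lebesgue_step /pushforward -comp_preimage.
by rewrite (_ : uncons \o _ = idfun) //; apply/funext => z; exact: tK.
Qed.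

HB.instance Definition _ := Measure_isSigmaFinite.Build _ _ _ lebesgue_step
  step_sigma_finite.

End step.

(* n-dimensional Lebesgue measure on the Borel sets of R^n, by the product
   R^(n+1) = R x R^n. *)
Fixpoint borel_lebesgue (n : nat) :
    {sigma_finite_measure set (n.-tuple R) -> \bar R} :=
  match n with
  | 0 => @dirac _ (0.-tuple R) [tuple] R
  | n'.+1 => lebesgue_step (borel_lebesgue n')
  end.

End borel_lebesgue.

(* R^n with the sigma-algebra of Lebesgue measurable sets (not only the Borel
   ones), obtained by Caratheodory completion. *)
Definition Rn (R : realType) (n : nat) :=
  caratheodory_type (mu_ext (@borel_lebesgue R n)).
HB.instance Definition _ (R : realType) (n : nat) := Measurable.on (Rn R n).

Definition leb (R : realType) (n : nat) : set (Rn R n) -> \bar R :=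
  @completed_measure_extension _ _ _ (@borel_lebesgue R n).
HB.instance Definition _ (R : realType) (n : nat) := Measure.on (@leb R n).

Lemma leb_sigma_finite (R : realType) (n : nat) :
  sigma_finite setT (@leb R n).
Proof. exact/completed_measure_extension_sigma_finite/sigma_finiteT. Qed.

HB.instance Definition _ (R : realType) (n : nat) :=
  Measure_isSigmaFinite.Build _ _ _ (@leb R n) (@leb_sigma_finite R n).
Arguments leb : clear implicits.

Section functional.
Context {R : realType} {n : nat}.
Implicit Types (x y : Rn R n) (Om : set (Rn R n)) (u v : Rn R n -> R).
Local Notation mu := (leb R n).

(* Euclidean distance: tuples carry no norm *)
Definition edist x y : R :=
  Num.sqrt (\sum_(i < n) (tnth x i - tnth y i) ^+ 2).

Definition origin : Rn R n := [tuple 0 | i < n].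

Definition eball (r : R) : set (Rn R n) := [set x | edist x origin < r].

(* essential supremum over D *)
Definition ess_sup_on (D : set (Rn R n)) (f : Rn R n -> \bar R) : \bar R :=
  ess_sup mu (fun x => if x \in D then f x else -oo%E).

(* oriented integral from 0 to t *)
Definition primitive0 (f : R -> R) (t : R) : R :=
  if 0 <= t then \int[lebesgue_measure]_(x in `[0, t]) f x
  else - \int[lebesgue_measure]_(x in `[t, 0]) f x.

Definition Gfun (g : R -> R) : R -> R := primitive0 g.
Definition calG (g : R -> R) : R -> R := primitive0 (Gfun g).

Definition Qdom Om : set (Rn R n * Rn R n) := ~` ((~` Om) `*` (~` Om)).

(* In the kernels below the value on the null diagonal is 0, as 0^-1 = 0. *)
Definition Ws (s : R) Om : set (Rn R n -> R) := [set u |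
  [/\ measurable_fun setT u,
      mu.-integrable Om (EFin \o u) &
      (\int[mu]_(x in Om) \int[mu]_(y in Om)
         (`|u x - u y| / edist x y `^ (n%:R + s))%:E < +oo)%E]].

Definition energy_diff (s : R) (g : R -> R) Om u v : \bar R :=
  (\int[mu \x mu]_(z in Qdom Om)
     ((calG g ((u z.1 - u z.2) / edist z.1 z.2)
       - calG g ((v z.1 - v z.2) / edist z.1 z.2))
      / edist z.1 z.2 `^ (n%:R - 1 + s))%:E)%E.

Definition subminimizer (s : R) (g : R -> R) Om u : Prop :=
  Ws s Om u /\
  forall v, Ws s Om v ->
    (\forall x \ae mu, ~ Om x -> v x = u x) ->
    (\forall x \ae mu, Om x -> v x <= u x) ->
    (energy_diff s g Om u v <= 0)%E.

End functional.
Arguments eball {R} n r.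

(* Main.v *)
Require Import Defs.
From mathcomp Require Import all_boot all_order all_algebra.
From mathcomp Require Import all_classical all_reals all_analysis.
From mathcomp Require Import ess_sup_inf measurable_realfun lra ring.
Import Order.TTheory GRing.Theory Num.Theory.
Import numFieldNormedType.Exports.
Set Implicit Arguments.
Unset Strict Implicit.
Unset Printing Implicit Defensive.
Local Open Scope classical_set_scope.
Local Open Scope ring_scope.

(* The function [calG g] has linear growth with one and the same slope [La] on
   both sides: La|t| - c <= calG t <= La|t|, where [La] is the integral of [g]
   over the half-line and [c] is a first moment of [g].
   Testing subminimality with v = u - eta (u - k)_+ therefore costs only a
   multiple of c per pair of points, and bounds the s-energy of eta (u - k)_+ by
   d^-s int (u - k)_+ + d^(1-s) |{u > k}|. If the level set fills at most half
   of each ball of radius r, the energy bounds r^-s int eta (u - k)_+ from below,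
   by interaction with the complement of the level set. With r small compared to
   d this is a gain of a fixed small factor, which a De Giorgi iteration over
   shrinking balls and growing levels turns into an L^1-to-L^infinity bound.
   The argument only needs the volumes of balls to be comparable with r^n, so it
   is carried out in Ahlfors regular spaces. *)

(** What the competitor loses per pair is weighed by |x-y|^-(n-1+s), which is integrable at the
    diagonal, while the gain carries |x-y|^-(n+s), which is not. With different slopes above and
    below, a multiple of |u(x)-u(y)| |x-y|^-(n+s) would be lost as well, and (u-k)_+ does not
    control it. The term d^(1-s) |{u > k'}| is not homogeneous in u. Chebyshev's inequality bounds
    |{u > k'}| by int (u-k)_+ / (k'-k), and this brings the term to the order of d^-s int (u-k)_+
    once k'-k is at least d. Hence the levels rise in proportion to the radii, and the final level
    is taken at least R: this is the origin of the additive R. The recursion is linear, without the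
    superlinear power of the classical scheme. It closes because the half-ball condition at step j
    only asks the integral to lie below a threshold of order 2^-(n+1)j, and the ratio of r to d is
    chosen once so that every step gains the factor 2^-(n+1). *)

Section primitive.
Context {R : realType}.
Local Notation leb1 := (@lebesgue_measure R).
Implicit Types f F : R -> R.

(** * Oriented primitives and their derivatives *)

Lemma continuous_integrable_itv f a b :
  continuous f -> leb1.-integrable `[a, b] (EFin \o f).
Proof.
move=> cf; apply: continuous_compact_integrable; first exact: segment_compact.
exact: continuous_subspaceT.
Qed.

(** Rebasing at a point left of both 0 and [t] removes the sign split of [primitive0]: what varies
    is an integral with a fixed left end. *)
Lemma primitive0E f a t : continuous f -> a <= 0 -> a <= t ->
  primitive0 f t = \int[leb1]_(x in `[a, t]) f x - \int[leb1]_(x in `[a, 0]) f x.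
Proof.
move=> cf a0 at_; rewrite /primitive0; case: ifPn => [t0|].
  rewrite Rintegral_itvB ?bnd_simp//; last exact: continuous_integrable_itv.
  rewrite Rintegral_itv_obnd_cbnd//.
  apply: (@integrableS _ _ _ leb1 `[0, t]) => //.
    by apply: subset_itvr; rewrite bnd_simp.
  exact: continuous_integrable_itv.
rewrite -ltNge => /ltW t0.
rewrite -[RHS]opprB Rintegral_itvB ?bnd_simp//;
  last exact: continuous_integrable_itv.
rewrite Rintegral_itv_obnd_cbnd//.
apply: (@integrableS _ _ _ leb1 `[t, 0]) => //.
  by apply: subset_itvr; rewrite bnd_simp.
exact: continuous_integrable_itv.
Qed.

Lemma is_derive_primitive0 f (x : R) :
  continuous f -> is_derive x 1 (primitive0 f) (f x).
Proof.
(* [a] lies strictly left of [x], so the rebased formula is valid on a whole neighbourhood of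
   [x]. *)
move=> cf; pose a := Num.min x 0 - 1.
have a0 : a <= 0 by rewrite /a minEle; case: ifPn; lra.
have ax : a < x by rewrite /a minEle; case: ifPn; lra.
have xu : x < x + 1 by rewrite ltrDl.
have [dF FE] := @continuous_FTC1_closed _ f _ _ _ xu
  (continuous_integrable_itv a (x + 1) cf) ax (cf x).
pose F y := \int[leb1]_(t in `[a, y]) f t.
have HF : is_derive x 1 F (f x).
  by apply: DeriveDef; [exact: dF|rewrite -derive1E; exact: FE].
apply: (@near_eq_is_derive _ _ _ (F \- cst (F 0))).
  near=> y; rewrite (@primitive0E _ a)//.
  by apply: ltW; near: y; exact: lt_nbhsr.
rewrite -[f x]subr0; apply: is_deriveB.
Unshelve. all: by end_near. Qed.

Lemma primitive00 f : primitive0 f 0 = 0.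
Proof. by rewrite /primitive0 lexx set_itv1 Rintegral_set1. Qed.

Lemma is_derive_mvt F f a b : (forall x : R, is_derive x 1 F (f x)) -> a <= b ->
  exists2 c, a <= c <= b & F b - F a = f c * (b - a).
Proof.
move=> dF ab.
have [|c cab E] := @MVT_segment R F f a b ab (fun x _ => dF x).
  apply: derivable_within_continuous => x _.
  by have [] := dF x.
by exists c => //; move: cab; rewrite in_itv.
Qed.

Lemma is_derive_ge0_le F f a b : (forall x : R, is_derive x 1 F (f x)) ->
  (forall x, a <= x <= b -> 0 <= f x) -> a <= b -> F a <= F b.
Proof.
move=> dF f0 ab; have [c cab E] := is_derive_mvt dF ab.
by rewrite -subr_ge0 E mulr_ge0 ?subr_ge0// f0.
Qed.

Lemma is_derive_continuous F f :
  (forall x : R, is_derive x 1 F (f x)) -> continuous F.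
Proof.
move=> dF x; apply/differentiable_continuous/derivable1_diffP.
by have [] := dF x.
Qed.

End primitive.

(** * Parity of primitives, by differentiating a reflection *)

Section parity.
Context {R : realType}.
Implicit Types f : R -> R.

Let is_derive_reflect f (x df : R) :
  is_derive (- x) 1 f df -> is_derive x 1 (fun y => f (- y)) (- df).
Proof.
move=> fd; have -> : - df = df * (-1) by rewrite mulrN1.
exact: (@is_derive1_comp _ f -%R x).
Qed.

Let const_of_derive0 f : (forall x : R, is_derive x 1 f 0) -> forall x, f x = f 0.
Proof.
move=> df x; apply/eqP; rewrite eq_le; case: (leP 0 x) => x0; apply/andP; split.
- rewrite -lerN2; apply: (@is_derive_ge0_le _ (fun y => - f y) (cst 0)) => //= y.
  by rewrite /cst -[0]oppr0; apply: is_deriveN.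
- by apply: (@is_derive_ge0_le _ f (cst 0)).
- by apply: (@is_derive_ge0_le _ f (cst 0)) => //; exact: ltW.
- rewrite -lerN2; apply: (@is_derive_ge0_le _ (fun y => - f y) (cst 0)) => //=.
    by move=> y; rewrite /cst -[0]oppr0; apply: is_deriveN.
  exact: ltW.
Qed.

Lemma primitive0_odd f : continuous f -> (forall t, f (- t) = f t) ->
  forall t, primitive0 f (- t) = - primitive0 f t.
Proof.
move=> cf ef t; apply/eqP; rewrite -addr_eq0; apply/eqP.
pose h y := primitive0 f (- y) + primitive0 f y.
have -> : primitive0 f (- t) + primitive0 f t = h t by [].
have dh (x : R) : is_derive x 1 h 0.
  have -> : (0 : R) = - f (- x) + f x by rewrite ef addNr.
  apply: is_deriveD; last exact: is_derive_primitive0.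
  exact/is_derive_reflect/is_derive_primitive0.
by rewrite (const_of_derive0 dh) /h oppr0 primitive00 addr0.
Qed.

Lemma primitive0_even f : continuous f -> (forall t, f (- t) = - f t) ->
  forall t, primitive0 f (- t) = primitive0 f t.
Proof.
move=> cf ef t; apply/eqP; rewrite -subr_eq0; apply/eqP.
pose h y := primitive0 f (- y) - primitive0 f y.
have -> : primitive0 f (- t) - primitive0 f t = h t by [].
have dh (x : R) : is_derive x 1 h 0.
  have -> : (0 : R) = - f (- x) - f x by rewrite ef opprK subrr.
  apply: is_deriveB; last exact: is_derive_primitive0.
  exact/is_derive_reflect/is_derive_primitive0.
by rewrite (const_of_derive0 dh) /h oppr0 primitive00 subr0.
Qed.

End parity.

(** * Linear growth of [calG g] with equal slopes on both sides *)

Section excess.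
Context {R : realType}.
Local Notation leb1 := (@lebesgue_measure R).
Variable g : R -> R.
Hypothesis g_range : forall t, 0 < g t <= 1.
Hypothesis g_even : forall t, g (- t) = g t.
Hypothesis g_cont : continuous g.
Hypothesis g_int : (\int[leb1]_t (g t * `|t|)%:E < +oo)%E.

Let g0 t : 0 < g t. Proof. by have /andP[] := g_range t. Qed.

Let dG (x : R) : is_derive x 1 (Gfun g) (g x).
Proof. exact: is_derive_primitive0. Qed.

Let G_cont : continuous (Gfun g).
Proof. exact: (is_derive_continuous dG). Qed.

Let dcalG (x : R) : is_derive x 1 (calG g) (Gfun g x).
Proof. exact: is_derive_primitive0. Qed.

Lemma continuous_calG : continuous (calG g).
Proof. exact: (is_derive_continuous dcalG). Qed.

Lemma calG_even t : calG g (- t) = calG g t.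
Proof. by apply: primitive0_even => //; exact: primitive0_odd. Qed.

Let tg t : R := g t * `|t|.

Let tg_cont : continuous tg.
Proof.
move=> x; apply: cvgM; first exact: g_cont.
exact: norm_continuous.
Qed.

Let K : R -> R := primitive0 tg.

Let dK (x : R) : is_derive x 1 K (tg x).
Proof. exact: is_derive_primitive0. Qed.

Definition excess : R := fine (\int[leb1]_t (g t * `|t|)%:E).

Let K_le t : 0 <= t -> K t <= excess.
Proof.
move=> t0; rewrite /K /primitive0 t0 /excess /Rintegral fine_le//.
- by apply: integrable_fin_num => //; exact: continuous_integrable_itv.
- rewrite ge0_fin_numE//; apply: integral_ge0 => x _.
  by rewrite lee_fin mulr_ge0 ?normr_ge0// ltW.
- apply: ge0_subset_integral => //=.
    by apply/measurable_EFinP; exact: continuous_measurable_fun.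
  by move=> x _; rewrite lee_fin mulr_ge0 ?normr_ge0// ltW.
Qed.

Let G_mono a b : a <= b -> Gfun g a <= Gfun g b.
Proof. by apply: is_derive_ge0_le => // x _; exact: ltW. Qed.

Let G_odd t : Gfun g (- t) = - Gfun g t.
Proof. exact: primitive0_odd. Qed.

(** Integration by parts gives calG(t) = t G(t) - K(t), and t (G(T) - G(t)) <= K(T) - K(t) because
    the integration variable is at least [t] on [t, T]. In the sum only K(T) <= [excess] remains.
    Since [T] is free, G(T) may afterwards be replaced by its supremum. *)
Let tG_le t T : 0 <= t <= T -> t * Gfun g T <= excess + calG g t.
Proof.
move=> /andP[t0 tT].
have H1 : K t - t * Gfun g t <= K T - t * Gfun g T.
  apply: (@is_derive_ge0_le _ (K - t *: Gfun g) (fun x => tg x - t *: g x)) => //.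
    by move=> x; apply: is_deriveB; last exact: (@is_deriveZ _ _ _ (Gfun g) t).
  move=> x /andP[tx _]; rewrite /tg ger0_norm; last exact: le_trans tx.
  by rewrite -[t *: _]/(t * _) (mulrC (g x)) -mulrBl mulr_ge0 ?subr_ge0// ltW.
have H2 : K t - t * Gfun g t + calG g t >= 0.
  pose F := K - (fun x => x) * Gfun g + calG g.
  have dF (x : R) : is_derive x 1 F (tg x - (x *: g x + Gfun g x *: 1) + Gfun g x).
    have dM : is_derive x 1 ((fun x : R => x) * Gfun g) (x *: g x + Gfun g x *: 1).
      exact: is_deriveM.
    have dB : is_derive x 1 (K - (fun x : R => x) * Gfun g)
        (tg x - (x *: g x + Gfun g x *: 1)).
      exact: is_deriveB.
    exact: is_deriveD.
  have -> : 0 = F 0.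
    by rewrite /F !fctE /K /calG !primitive00 mul0r subrr addr0.
  apply: (is_derive_ge0_le dF) => // x /andP[x0 _].
  by rewrite /tg ger0_norm// -!/(_ * _) /GRing.scale /=; lra.
have := K_le (le_trans t0 tT); lra.
Qed.

(** The limit at infinity of the increasing function [Gfun g], written as a supremum. Its finiteness
    comes from the first moment of [g], through [tG_le] at t = 1. *)
Definition slope : R := sup (range (Gfun g)).

Let G_slope t : Gfun g t <= slope.
Proof.
apply: ub_le_sup; last by exists t.
exists (excess + calG g 1) => _ [x _ <-].
have := tG_le (t := 1) (T := Num.max x 1).
rewrite ler01 le_max lexx orbT mul1r => /(_ isT).
by apply: le_trans; apply: G_mono; rewrite le_max lexx.
Qed.

Lemma slope_gt0 : 0 < slope.
Proof.
apply: lt_le_trans (G_slope 1).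
have [c _] := is_derive_mvt dG ler01.
by rewrite /Gfun primitive00 !subr0 mulr1 => ->.
Qed.

Lemma excess_ge0 : 0 <= excess.
Proof.
apply: fine_ge0; apply: integral_ge0 => x _.
by rewrite lee_fin mulr_ge0 ?normr_ge0// ltW.
Qed.

Lemma calG_lip a b : `|calG g a - calG g b| <= slope * `|a - b|.
Proof.
wlog ab : a b / a <= b => [H|].
  have [ab|/ltW ba] := leP a b; first exact: H.
  by rewrite distrC (distrC a); exact: H.
have [c _ E] := is_derive_mvt dcalG ab.
rewrite distrC E normrM (distrC b) (distrC a) ler_wpM2r//.
rewrite ler_norml G_slope andbT lerNl -G_odd; exact: G_slope.
Qed.

Lemma calG_le t : calG g t <= slope * `|t|.
Proof.
have := calG_lip t 0; rewrite subr0 {2}/calG primitive00 subr0.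
exact/le_trans/ler_norm.
Qed.

(** For t > 0, dividing [tG_le] by [t] bounds G(T) uniformly in T >= t, hence also its supremum;
    negative [t] follow by evenness. *)
Lemma calG_ge t : slope * `|t| - excess <= calG g t.
Proof.
wlog t0 : t / 0 <= t => [H|].
  have [t0|/ltW t0] := leP 0 t; first exact: H.
  by rewrite -normrN -calG_even H// oppr_ge0.
rewrite ger0_norm// lerBlDl.
have [->|tn0] := eqVneq t 0.
  by rewrite mulr0 /calG primitive00 addr0 excess_ge0.
have tp : 0 < t by rewrite lt_def tn0.
rewrite -ler_pdivlMr//; apply: ge_sup; first by exists (Gfun g 0), 0.
move=> _ [x _ <-]; rewrite ler_pdivlMr// mulrC.
have := tG_le (t := t) (T := Num.max x t).
rewrite t0 le_max lexx orbT => /(_ isT); apply: le_trans.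
by rewrite ler_wpM2l// G_mono// le_max lexx.
Qed.

End excess.

(** * Balls, kernels and regularity in a metric measure space *)

Definition nbh {R : realType} {T : Type} (D : T -> T -> R) (x : T) (r : R) : set T :=
  [set y | D y x < r].

Definition kern {R : realType} {T : Type} (D : T -> T -> R) (p : R) (x y : T) : R :=
  (D x y `^ p)^-1.

(* Ahlfors regularity of dimension m for a metric measure space *)
Record regular_space {R : realType} {d} {T : measurableType d}
    (mu : {sigma_finite_measure set T -> \bar R})
    (D : T -> T -> R) (m : nat) (cl cu : R) : Prop := RegularSpace {
  dist_ge0 : forall x y, 0 <= D x y;
  dist_sym : forall x y, D x y = D y x;
  dist_tri : forall x y z, D x z <= D x y + D y z;
  dist_eq0 : forall x y, D x y = 0 -> x = y;
  dist_meas : measurable_fun [set: T * T] (fun z => D z.1 z.2);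
  cl_gt0 : 0 < cl;
  cu_gt0 : 0 < cu;
  ball_ge : forall x r, 0 < r -> ((cl * r ^+ m)%:E <= mu (nbh D x r))%E;
  ball_le : forall x r, 0 < r -> (mu (nbh D x r) <= (cu * r ^+ m)%:E)%E
}.

(** * Geometric sums and dyadic scales *)

Section geometric.
Context {R : realType}.

Lemma geometric_sum_le (A q : R) N : 0 <= A -> 0 <= q < 1 ->
  \sum_(0 <= j < N) A * q ^+ j <= A / (1 - q).
Proof.
move=> A0 /andP[q0 q1]; have q10 : 0 < 1 - q by rewrite subr_gt0.
suff -> : \sum_(0 <= j < N) A * q ^+ j = A * (1 - q ^+ N) / (1 - q).
  rewrite ler_pM2r ?invr_gt0// ler_piMr// gerBl exprn_ge0//.
elim: N => [|N IH]; first by rewrite big_geq// expr0 subrr mulr0 mul0r.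
rewrite big_nat_recr//= IH exprS; field.
by rewrite gt_eqF.
Qed.

Lemma exists_dyadic_up (t b : R) : 0 < b -> b <= t ->
  exists j : nat, b * 2 ^+ j <= t < b * 2 ^+ j.+1.
Proof.
move=> b0 bt; have t0 : 0 < t := lt_le_trans b0 bt.
have ex : exists j, t < b * 2 ^+ j.
  exists (Num.bound (t / b)); rewrite -ltr_pdivrMl// mulrC.
  apply: lt_le_trans (archi_boundP (divr_ge0 (ltW t0) (ltW b0))) _.
  by rewrite -natrX ler_nat ltnW// ltn_expl.
case: (ex_minnP ex) => -[|j] tj jmin; first by rewrite expr0 mulr1 ltNge bt in tj.
exists j; rewrite tj andbT leNgt; apply/negP => /jmin.
by rewrite ltnn.
Qed.

Lemma exists_dyadic_down (t b : R) : 0 < t -> t < b ->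
  exists j : nat, b * 2^-1 ^+ j / 2 <= t < b * 2^-1 ^+ j.
Proof.
move=> t0 tb; have b0 : 0 < b := lt_trans t0 tb.
have ex : exists j, b * 2^-1 ^+ j.+1 <= t.
  exists (Num.bound (b / t)); rewrite exprVn ler_pdivrMr ?exprn_gt0//.
  rewrite -ler_pdivrMl// mulrC.
  apply/ltW/(lt_le_trans (archi_boundP (divr_ge0 (ltW b0) (ltW t0)))).
  by rewrite -natrX ler_nat ltnW// ltnW// ltn_expl.
case: (ex_minnP ex) => j tj jmin; exists j.
rewrite -mulrA -exprSr tj /=; case: j => [|j] in tj jmin *.
  by rewrite expr0 mulr1.
by rewrite ltNge; apply/negP => /jmin; rewrite ltnn.
Qed.

End geometric.

(** * Integrals of the kernel near a point and away from it *)

Section kernel.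
Context {R : realType} {d} {T : measurableType d}.
Variables (mu : {sigma_finite_measure set T -> \bar R}).
Variables (D : T -> T -> R) (m : nat) (cl cu : R).
Hypothesis reg : regular_space mu D m cl cu.

Lemma measurable_dist_l x : measurable_fun setT (fun y => D y x).
Proof. exact: (measurable_fun_pair1 x (dist_meas reg)). Qed.

Lemma measurable_nbh x r : measurable (nbh D x r).
Proof.
have := measurable_fun_ltr (measurable_dist_l x) (measurable_cst r).
by move=> /(_ measurableT [set true] I); rewrite setTI.
Qed.

Lemma kern_ge0 p x y : 0 <= kern D p x y.
Proof. by rewrite invr_ge0 powR_ge0. Qed.

Lemma measurable_kern p :
  measurable_fun [set: T * T] (fun z => kern D p z.1 z.2).
Proof.
rewrite [X in measurable_fun _ X](_ : _ = (@powR R ^~ (- p)) \o (fun z => D z.1 z.2)).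
  by apply: measurableT_comp; [exact: measurable_powR|exact: dist_meas reg].
by apply/funext => z; rewrite /kern /= powRN.
Qed.

Lemma measurable_kern_r p x : measurable_fun setT (kern D p x).
Proof. exact: (measurable_fun_pair2 x (measurable_kern p)). Qed.

(* Dyadic decomposition: [lam] is 1/2 near the diagonal and 2 away from it. *)
Lemma kernel_integral p b lam x (S : set T) :
  0 <= p -> 0 < b -> 0 < lam -> lam `^ (m%:R - p) < 1 -> measurable S ->
  (forall y, S y -> exists j : nat, b * lam ^+ j / 2 <= D x y < b * lam ^+ j) ->
  (\int[mu]_y (\1_S y * kern D p x y)%:E <=
    (cu * 2 `^ p / (1 - lam `^ (m%:R - p)) * b `^ (m%:R - p))%:E)%E.
Proof.
move=> p0 b0 lam0 q1 mS Sx; have cu0 := cu_gt0 reg.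
pose r j := b * lam ^+ j.
have r0 j : 0 < r j by rewrite mulr_gt0// exprn_gt0.
(* [a j] is (r j / 2)^-p, the largest value of the kernel on the j-th shell. Enlarging the shell to
   the ball of radius [r j] makes its share cu 2^p (r j)^(m-p), which is geometric in j with ratio
   lam^(m-p). *)
pose a j := 2 `^ p * (r j `^ p)^-1.
have a0 j : 0 <= a j by rewrite mulr_ge0 ?powR_ge0// invr_ge0 powR_ge0.
pose h j y := (a j * \1_(nbh D x (r j)) y)%:E.
have h0 j y : (0 <= h j y)%E by rewrite lee_fin mulr_ge0// indicE ler0n.
have mh j : measurable_fun setT (h j).
  apply/measurable_EFinP/measurable_funM => //.
  exact/measurable_indic/measurable_nbh.
pose A := cu * 2 `^ p * b `^ (m%:R - p).
have A0 : 0 <= A by rewrite !mulr_ge0 ?powR_ge0// ltW.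
apply: (@le_trans _ _ (\int[mu]_y (\big[+%E/0%R]_(0 <= n <oo) h n y))%E).
  apply: ge0_le_integral => //=.
  - by move=> y _; rewrite lee_fin mulr_ge0 ?kern_ge0// indicE ler0n.
  - apply/measurable_EFinP/measurable_funM; first exact: measurable_indic.
    exact: measurable_kern_r.
  - apply: ge0_emeasurable_sum => // k y _ _; exact: h0.
  - move=> y _; have [/[dup] Sy /Sx[j /andP[j1 j2]]|nSy] := pselect (S y); last first.
      by rewrite indicE memNset// mul0r; apply: nneseries_ge0 => k _ _; exact: h0.
    rewrite indicE mem_set// mul1r.
    apply: le_trans (nneseries_lim_ge j.+1 _) => //.
    rewrite big_nat_recr//= -[leLHS]add0e; apply: leeD.
      by apply: sume_ge0 => k _; exact: h0.
    rewrite lee_fin indicE mem_set ?mulr1; last by rewrite /nbh /= (dist_sym reg).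
    have -> : a j = ((r j / 2) `^ p)^-1.
      have E2 : 2^-1 `^ p = (2 `^ p)^-1 :> R.
        by rewrite -(powR_inv1 (ler0n R 2)) -powRrM mulN1r powRN.
      by rewrite powRM ?invr_ge0// ?(ltW (r0 j))// E2 invfM invrK mulrC.
    have r20 : 0 < r j / 2 by rewrite divr_gt0.
    rewrite /kern lef_pV2 ?posrE ?powR_gt0//; last exact: lt_le_trans j1.
    by rewrite ge0_ler_powR// nnegrE ltW// (lt_le_trans r20).
rewrite integral_nneseries//.
have hj j : (\int[mu]_y h j y <= (A * (lam `^ (m%:R - p)) ^+ j)%:E)%E.
  under eq_integral do rewrite /h EFinM.
  rewrite ge0_integralZl_EFin//; last first.
    exact/measurable_EFinP/measurable_indic/measurable_nbh.
  rewrite integral_indic//; last exact: measurable_nbh.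
  rewrite setIT; apply: (@le_trans _ _ ((a j)%:E * (cu * r j ^+ m)%:E)%E).
    by rewrite lee_wpmul2l ?lee_fin//; exact: ball_le reg _ _ (r0 j).
  rewrite -EFinM lee_fin.
  have -> : a j * (cu * r j ^+ m) = cu * 2 `^ p * (r j ^+ m * (r j `^ p)^-1).
    by rewrite /a; ring.
  rewrite -(@powR_mulrn _ (r j) m) ?(ltW (r0 j))// -(powRN (r j)) -powRD; last first.
    by rewrite (gt_eqF (r0 j)) implybT.
  rewrite /A /r powRM ?(ltW b0) ?exprn_ge0 ?(ltW lam0)//.
  rewrite -(@powR_mulrn _ lam) ?(ltW lam0)// -powRrM (mulrC j%:R) powRrM.
  by rewrite powR_mulrn ?powR_ge0// !mulrA.
apply: (le_trans (lee_nneseries _ (fun j _ => hj j))).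
  by move=> j _ _; apply: integral_ge0 => y _; exact: h0.
apply: lime_le.
  apply: is_cvg_nneseries => j _ _.
  by rewrite lee_fin mulr_ge0// exprn_ge0// powR_ge0.
apply: nearW => N; rewrite sumEFin lee_fin.
apply: le_trans (geometric_sum_le _ _ _) _ => //; first by rewrite powR_ge0.
by rewrite /A mulrAC.
Qed.

Variable s : R.
Hypothesis (hs : 0 < s < 1) (hm : (1 <= m)%N).
Local Notation k0 := (kern D (m%:R - 1 + s)).
Local Notation k1 := (kern D (m%:R + s)).

(** The constant of [kernel_integral] for lam = 1/2, p = m-1+s and b = r, where m-p = 1-s. *)
Definition near_const : R :=
  cu * 2 `^ (m%:R - 1 + s) / (1 - 2^-1 `^ (1 - s)).

(** The constant of [kernel_integral] for lam = 2, p = m+s and b = 2r: the j-th outer shell ends at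
    r 2^(j+1), whence the additional 2^-s. *)
Definition far_const : R :=
  cu * 2 `^ (m%:R + s) / (1 - 2 `^ (- s)) * 2 `^ (- s).

Let m1 : 1 <= m%:R :> R. Proof. by rewrite ler1n. Qed.

Let half_lt1 : 2^-1 `^ (1 - s) < 1 :> R.
Proof.
have E1 : 1 = 1 `^ (1 - s) :> R by rewrite powR1.
rewrite [ltRHS]E1 gt0_ltr_powR ?nnegrE//; move: hs => /andP[? ?]; lra.
Qed.

Let two_lt1 : 2 `^ (- s) < 1 :> R.
Proof.
move: hs => /andP[s0 _].
have E1 : 1 = 1 `^ s :> R by rewrite powR1.
rewrite powRN invf_lt1 ?powR_gt0// [ltLHS]E1 gt0_ltr_powR ?nnegrE//.
by rewrite ltr1n.
Qed.

Lemma near_const_ge0 : 0 <= near_const.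
Proof.
have := half_lt1; have := cu_gt0 reg => ? ?.
by rewrite divr_ge0 ?subr_ge0 ?mulr_ge0 ?powR_ge0 ?ltW.
Qed.

Lemma far_const_ge0 : 0 <= far_const.
Proof.
have := two_lt1; have := cu_gt0 reg => ? ?.
by rewrite mulr_ge0 ?divr_ge0 ?subr_ge0 ?mulr_ge0 ?powR_ge0 ?ltW.
Qed.

Lemma kern_near x r : 0 < r ->
  (\int[mu]_y (\1_(nbh D x r) y * k0 x y)%:E <= (near_const * r `^ (1 - s))%:E)%E.
Proof.
move=> r0; move: hs m1 => /andP[s0 s1] m1'.
have mE : 1 - s = m%:R - (m%:R - 1 + s) by lra.
pose S := nbh D x r `&` [set y | 0 < D y x].
have mS : measurable S.
  apply: measurableI; first exact: measurable_nbh.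
  have := measurable_fun_ltr (measurable_cst (0 : R)) (measurable_dist_l x).
  by move=> /(_ measurableT [set true] I); rewrite setTI.
rewrite (eq_integral (fun y => (\1_S y * k0 x y)%:E)); last first.
  move=> y _; congr (_%:E); rewrite !indicE in_setI.
  have [Dy|] := boolP (0 < D y x); first by rewrite [y \in [set _ | _]]mem_set// andbT.
  rewrite -leNgt (dist_sym reg) => Dy; suff -> : k0 x y = 0 by rewrite !mulr0.
  have D0 : D x y = 0 by apply/eqP; rewrite eq_le Dy (dist_ge0 reg).
  by rewrite /kern D0 powR0 ?invr0// gt_eqF//; lra.
rewrite /near_const mE; apply: kernel_integral => //.
- by lra.
- by rewrite -mE.
- by move=> y [yr /= y0]; apply: exists_dyadic_down; rewrite (dist_sym reg).
Qed.

Lemma kern_far x r : 0 < r ->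
  (\int[mu]_y (\1_(~` nbh D x r) y * k1 x y)%:E <= (far_const * r `^ (- s))%:E)%E.
Proof.
move=> r0; move: hs => /andP[s0 s1].
have mE : - s = m%:R - (m%:R + s) by lra.
rewrite /far_const -mulrA -powRM// ?(ltW r0)// {1 2}mE.
apply: kernel_integral => //.
- by rewrite addr_ge0// ltW.
- by rewrite mulr_gt0.
- by rewrite -mE two_lt1.
- exact/measurableC/measurable_nbh.
- move=> y; rewrite /nbh /= => /negP; rewrite -leNgt (dist_sym reg) => rD.
  have [j /andP[j1 j2]] := exists_dyadic_up r0 rD; exists j.
  have -> : 2 * r * 2 ^+ j / 2 = r * 2 ^+ j by field.
  by rewrite (mulrC 2) -mulrA -exprS j1.
Qed.

(** Valid on the diagonal too, where both sides are 0. [k0] weighs difference quotients, [k1] weighs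
    differences. *)
Lemma kernE x y : k1 x y = k0 x y / D x y.
Proof.
move: hs m1 => /andP[s0 s1] m1'.
rewrite /kern -invfM (_ : m%:R + s = (m%:R - 1 + s) + 1); last by lra.
rewrite powRD ?powRr1 ?(dist_ge0 reg)//.
by rewrite gt_eqF//; lra.
Qed.

Lemma kern_dist x y : k1 x y * D x y = k0 x y.
Proof.
have [E|D0] := eqVneq (D x y) 0; last by rewrite kernE divfK.
rewrite E mulr0 /kern E powR0 ?invr0// gt_eqF//; move: hs m1 => /andP[s0 s1] m1'; lra.
Qed.

End kernel.

(** * The gain from truncating above a level *)

Section truncation_gain.
Context {R : realType}.
Implicit Types a b k : R.

Definition overshoot k a : R := Num.max (a - k) 0.

Lemma overshoot_ge0 k a : 0 <= overshoot k a.
Proof. by rewrite le_max lexx orbT. Qed.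

Lemma overshoot_le0 k a : a <= k -> overshoot k a = 0.
Proof. by move=> ak; rewrite /overshoot; apply/max_idPr; rewrite subr_le0. Qed.

Lemma maxr_lip c a b : `|Num.max a c - Num.max b c| <= `|a - b|.
Proof.
have h1 := ler_norm (a - b); have := ler_norm (b - a); rewrite distrC => h2.
case: (leP a c) => ac; case: (leP b c) => bc; rewrite ?subrr ?normr0 ?normr_ge0//;
  rewrite ler_norml; apply/andP; split; lra.
Qed.

Lemma minr_lip c a b : `|Num.min a c - Num.min b c| <= `|a - b|.
Proof.
have h1 := ler_norm (a - b); have := ler_norm (b - a); rewrite distrC => h2.
case: (leP a c) => ac; case: (leP b c) => bc; rewrite ?subrr ?normr0 ?normr_ge0//;
  rewrite ler_norml; apply/andP; split; lra.
Qed.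

Lemma overshoot_lip k a b : `|overshoot k a - overshoot k b| <= `|a - b|.
Proof.
apply: le_trans (maxr_lip _ _ _) _.
by rewrite opprB addrA subrK.
Qed.

(** [overshoot k] is nondecreasing and 1-Lipschitz, so removing the fraction [eb] of its increment
    from a - b is lossless: |t - eb dw| = |t| - eb |dw|. The variation of the cutoff leaves the
    remainder (ea - eb) wa, which is paid once in each of the two norms. Only the overshoot of [a]
    enters the error, so a pair can be oriented to put a point of the level set first. *)
Lemma overshoot_gain k a b ea eb : 0 <= ea <= 1 -> 0 <= eb <= 1 ->
  `|ea * overshoot k a - eb * overshoot k b| - 2 * (`|ea - eb| * overshoot k a) <=
  `|a - b| - `|(a - ea * overshoot k a) - (b - eb * overshoot k b)|.
Proof.
move=> /andP[ea0 ea1] /andP[eb0 eb1].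
set wa := overshoot k a; set wb := overshoot k b.
have wa0 : 0 <= wa := overshoot_ge0 k a.
set t := a - b; set dw := wa - wb.
have E : ea * wa - eb * wb = eb * dw + (ea - eb) * wa by rewrite /dw; ring.
have -> : (a - ea * wa) - (b - eb * wb) = t - (ea * wa - eb * wb).
  by rewrite /t; ring.
rewrite E.
have dwE : `|t - eb * dw| = `|t| - eb * `|dw|.
  rewrite /t /dw /wa /wb /overshoot.
  case: (leP (a - k) 0) => ?; case: (leP (b - k) 0) => ?; case: (leP b a) => ?;
    rewrite ?subrr ?normr0 ?mulr0 ?subr0 //.
  - by lra.
  - by rewrite (@ler0_norm _ (a - b)) ?(@ler0_norm _ (0 - _)) ?(@ler0_norm _ (_ - eb * _)); nra.
  - by rewrite (@ger0_norm _ (a - b)) ?(@ger0_norm _ (a - k)) ?(@ger0_norm _ (_ - eb * _)); nra.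
  - by lra.
  - by rewrite (@ger0_norm _ (a - b)) ?(@ger0_norm _ (a - k - _)) ?(@ger0_norm _ (_ - eb * _)); nra.
  - by rewrite (@ler0_norm _ (a - b)) ?(@ler0_norm _ (a - k - _)) ?(@ler0_norm _ (_ - eb * _)); nra.
have h1 : `|t - (eb * dw + (ea - eb) * wa)| <= `|t| - eb * `|dw| + `|ea - eb| * wa.
  rewrite -dwE opprD addrA; apply: (le_trans (ler_normB _ _)).
  by rewrite lerD2l normrM (ger0_norm wa0).
have h2 : `|eb * dw + (ea - eb) * wa| <= eb * `|dw| + `|ea - eb| * wa.
  by apply: (le_trans (ler_normD _ _)); rewrite !normrM (ger0_norm wa0) (ger0_norm eb0).
lra.
Qed.

End truncation_gain.

(** * Lipschitz cutoff functions *)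

Section cutoff.
Context {R : realType} {d} {T : measurableType d}.
Variables (mu : {sigma_finite_measure set T -> \bar R}).
Variables (D : T -> T -> R) (m : nat) (cl cu : R).
Hypothesis reg : regular_space mu D m cl cu.
Variables (o : T) (rho dd : R).
Hypothesis dd0 : 0 < dd.

Definition cutoff x : R := Num.max 0 (Num.min 1 ((rho + dd - D x o) / dd)).

Lemma cutoff_range x : 0 <= cutoff x <= 1.
Proof. by rewrite le_max lexx ge_max ler01 ge_min lexx. Qed.

Lemma cutoff_eq1 x : nbh D o rho x -> cutoff x = 1.
Proof.
rewrite /nbh /= => xr; rewrite /cutoff.
have H : 1 <= (rho + dd - D x o) / dd by rewrite ler_pdivlMr//; lra.
by rewrite (min_idPl H); apply/max_idPr.
Qed.

Lemma cutoff_neq0 x : cutoff x != 0 -> nbh D o (rho + dd) x.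
Proof.
rewrite /nbh /=; apply: contraNT; rewrite -leNgt => xr.
apply/eqP/max_idPl; rewrite ge_min; apply/orP; right.
by rewrite ler_pdivrMr// mul0r subr_le0.
Qed.

Lemma cutoff_lip x y : `|cutoff x - cutoff y| <= D x y / dd.
Proof.
rewrite /cutoff !(maxC 0) !(minC 1).
apply: le_trans (maxr_lip _ _ _) _; apply: le_trans (minr_lip _ _ _) _.
rewrite -mulrBl normrM normfV (gtr0_norm dd0) ler_pM2r ?invr_gt0//.
have h1 := dist_tri reg x y o; have h2 := dist_tri reg y x o.
have h3 := dist_sym reg x y.
rewrite ler_norml; apply/andP; split; lra.
Qed.

Lemma measurable_cutoff : measurable_fun setT cutoff.
Proof.
apply: measurable_maxr => //; apply: measurable_minr => //.
apply: measurable_funM => //; apply: measurable_funB => //.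
exact: measurable_dist_l reg o.
Qed.

End cutoff.

(** * Real-valued indicators *)

Section indicator.
Context {T : Type} {R : realType}.
Implicit Types (S : set T) (x : T).

Lemma indic_in S x : S x -> \1_S x = 1 :> R.
Proof. by move=> Sx; rewrite indicE mem_set. Qed.

Lemma indic_notin S x : ~ S x -> \1_S x = 0 :> R.
Proof. by move=> Sx; rewrite indicE memNset. Qed.

Lemma indic_ge0 S x : 0 <= \1_S x :> R.
Proof. by rewrite indicE ler0n. Qed.

Lemma indic_le1 S x : \1_S x <= 1 :> R.
Proof. by rewrite indicE lern1 leq_b1. Qed.

End indicator.

(** * Pointwise comparison of [u] with its truncation *)

Section lowering.
Context {R : realType} {d} {T : measurableType d}.
Variables (mu : {sigma_finite_measure set T -> \bar R}).
Variables (D : T -> T -> R) (m : nat) (cl cu : R).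
Hypothesis reg : regular_space mu D m cl cu.
Variable s : R.
Hypothesis (hs : 0 < s < 1) (hm : (1 <= m)%N).
Local Notation k0 := (kern D (m%:R - 1 + s)).
Local Notation k1 := (kern D (m%:R + s)).
Variables (Phi : R -> R) (La c : R).
Hypotheses (La0 : 0 < La) (c_ge0 : 0 <= c).
Hypothesis Phi_lip : forall a b, `|Phi a - Phi b| <= La * `|a - b|.
Hypothesis Phi_le : forall t, Phi t <= La * `|t|.
Hypothesis Phi_ge : forall t, La * `|t| - c <= Phi t.

Variables (o : T) (rho dd : R) (u : T -> R) (k : R).
Hypothesis dd0 : 0 < dd.
Local Notation eta := (cutoff D o rho dd).
Local Notation w x := (overshoot k (u x)).

(* De Giorgi truncation: [level_lower] is the competitor [u - eta (u - k)_+]. *)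
Definition upper_set : set T := [set x | k < u x] `&` nbh D o (rho + 2 * dd).
Local Notation A := upper_set.

Definition level_drop x : R := eta x * w x.
Definition level_lower x : R := u x - level_drop x.

Definition energy_density (v v' : T -> R) (z : T * T) : R :=
  (Phi ((v z.1 - v z.2) / D z.1 z.2) - Phi ((v' z.1 - v' z.2) / D z.1 z.2))
  / D z.1 z.2 `^ (m%:R - 1 + s).

(* [level_err1 x y + level_err1 y x] bounds what the competitor can lose: the
   cutoff gradient and [c] at distances below [dd], the kernel tail beyond. *)
Definition level_err1 (x y : T) : R :=
  \1_(nbh D x dd) y * (\1_A x * (2 * La / dd * w x + c)) * k0 x y
  + \1_(~` nbh D x dd) y * (La * level_drop x) * k1 x y.

Definition level_err (z : T * T) : R := level_err1 z.1 z.2 + level_err1 z.2 z.1.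

(* Points of the upper level set interact with the nearby points outside of it,
   which fill half of a small ball: this replaces a Sobolev inequality. *)
Definition level_low (r : R) (z : T * T) : R :=
  La * level_drop z.1 * (\1_(nbh D z.1 r) z.2 * \1_(~` A) z.2 * k1 z.1 z.2).

Let D0 := dist_ge0 reg.
Let Dsym := dist_sym reg.

Lemma drop_ge0 x : 0 <= level_drop x.
Proof.
have /andP[e0 _] := cutoff_range D o rho dd x.
by rewrite mulr_ge0 ?overshoot_ge0.
Qed.

Lemma drop_le x : level_drop x <= w x.
Proof.
have /andP[_ e1] := cutoff_range D o rho dd x.
by rewrite ler_piMl ?overshoot_ge0.
Qed.

Lemma drop_neq0 x : level_drop x != 0 -> k < u x /\ nbh D o (rho + dd) x.
Proof.
rewrite mulf_eq0 negb_or => /andP[e0 w0]; split; last exact: cutoff_neq0 e0.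
by rewrite ltNge; apply: contra w0 => /overshoot_le0 ->.
Qed.

Lemma drop_upper x : level_drop x != 0 -> A x.
Proof.
move=> /drop_neq0[ku xr]; split => //=; rewrite /nbh /= in xr *.
by apply: lt_le_trans xr _; move: dd0; lra.
Qed.

Lemma err1_ge0 x y : 0 <= level_err1 x y.
Proof.
have La_ge0 := ltW La0; have dV0 : 0 <= dd^-1 by rewrite invr_ge0 ltW.
apply: addr_ge0; apply: mulr_ge0; rewrite ?kern_ge0//;
  apply: mulr_ge0; rewrite ?indic_ge0//.
  by rewrite mulr_ge0 ?indic_ge0// addr_ge0// !mulr_ge0// overshoot_ge0.
by rewrite mulr_ge0// drop_ge0.
Qed.

Lemma err_ge0 z : 0 <= level_err z.
Proof. by rewrite addr_ge0 ?err1_ge0. Qed.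

Lemma low_ge0 r z : 0 <= level_low r z.
Proof.
apply: mulr_ge0; first by rewrite mulr_ge0 ?drop_ge0 ?ltW.
by rewrite !mulr_ge0 ?indic_ge0 ?kern_ge0.
Qed.

(** Meant for pairs at distance at least [dd]: there [k1] is integrable, and the Lipschitz bound on
    [Phi] is enough. *)
Lemma density_far x y :
  - (La * (level_drop x + level_drop y) * k1 x y) <=
    energy_density u level_lower (x, y).
Proof.
rewrite /energy_density /= -/(kern D _ x y) (kernE reg hs hm).
rewrite -mulNr mulrCA mulrC ler_wpM2r ?kern_ge0//.
set a := (u x - u y) / _; set b := (level_lower x - level_lower y) / _.
have h : `|a - b| <= (level_drop x + level_drop y) / D x y.
  rewrite /a /b -mulrBl normrM normfV (ger0_norm (D0 x y)).
  rewrite ler_wpM2r ?invr_ge0 ?D0//.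
  have -> : u x - u y - (level_lower x - level_lower y) = level_drop x - level_drop y.
    by rewrite /level_lower; ring.
  apply: le_trans (ler_normB _ _) _.
  by rewrite !ger0_norm ?drop_ge0.
have := Phi_lip a b; rewrite ler_norml => /andP[+ _]; apply: le_trans.
by rewrite mulNr lerN2 -mulrA ler_wpM2l// ltW.
Qed.

(* Here the linear growth of [Phi] from below is used with the same slope
   [La] as the growth from above. *)
Lemma density_near x y e :
  La * `|level_drop x - level_drop y| - 2 * La * e <=
    La * (`|u x - u y| - `|level_lower x - level_lower y|) ->
  La * `|level_drop x - level_drop y| * k1 x y <=
    energy_density u level_lower (x, y) + (2 * La * e * k1 x y + c * k0 x y).
Proof.
move=> H; have k1_0 := kern_ge0 D (m%:R + s) x y.
have := ler_wpM2r k1_0 H.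
rewrite /energy_density /= -/(kern D _ x y).
set a := (u x - u y) / _; set b := (level_lower x - level_lower y) / _.
have k0_0 := kern_ge0 D (m%:R - 1 + s) x y.
(* By homogeneity the parts La|a| and La|b| turn [k0] into [k1]; only the constant [c] stays with
   the milder kernel [k0]. *)
have h : La * (`|u x - u y| - `|level_lower x - level_lower y|) * k1 x y
    = (La * `|a| - La * `|b|) * k0 x y.
  rewrite /a /b !normrM normfV (ger0_norm (D0 x y)) (kernE reg hs hm); ring.
rewrite h.
have := ler_wpM2r k0_0 (lerB (Phi_ge a) (Phi_le b)).
lra.
Qed.

Lemma density_eq0 x y : level_drop x = 0 -> level_drop y = 0 ->
  energy_density u level_lower (x, y) = 0.
Proof. by move=> x0 y0; rewrite /energy_density /level_lower /= x0 y0 !subr0 subrr mul0r. Qed.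

Lemma err1_near x y : nbh D x dd y -> A x ->
  level_err1 x y = (2 * La / dd * w x + c) * k0 x y.
Proof.
move=> yx Ax; rewrite /level_err1 (indic_in yx) (indic_in Ax) indic_notin; last by apply.
by rewrite !mul0r addr0 !mul1r.
Qed.

Lemma err1_far x y : ~ nbh D x dd y -> level_err1 x y = La * level_drop x * k1 x y.
Proof.
move=> yx; rewrite /level_err1 (indic_notin yx) (indic_in (S := ~` nbh D x dd))//.
by rewrite !mul0r add0r mul1r.
Qed.

(** The cutoff varies by at most D x y / dd, and the factor D x y lowers the kernel from [k1] to
    [k0]: this is the term with 2 La / dd in [level_err1]. *)
Lemma density_near1 x y : nbh D x dd y -> level_drop x != 0 ->
  La * `|level_drop x - level_drop y| * k1 x y <=
    energy_density u level_lower (x, y) + level_err1 x y.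
Proof.
move=> yx dx; rewrite err1_near//; last exact: drop_upper.
have k1_0 := kern_ge0 D (m%:R + s) x y.
have La_ge0 := ltW La0.
apply: le_trans (density_near (e := `|eta x - eta y| * w x) _) _.
  have := ler_wpM2l La_ge0 (overshoot_gain k (u x) (u y)
    (cutoff_range D o rho dd x) (cutoff_range D o rho dd y)).
  by rewrite /level_lower /level_drop; lra.
have h := ler_wpM2r (overshoot_ge0 k (u x)) (cutoff_lip reg o rho dd0 x y).
have := ler_wpM2l (mulr_ge0 (mulr_ge0 (ler0n R 2) La_ge0) k1_0) h.
by rewrite lerD2l -(kern_dist reg hs hm); lra.
Qed.

(** Here only [y] is lowered, so [overshoot_gain] is applied to the reversed pair and the error is
    charged to [y]. *)
Lemma density_near2 x y : nbh D x dd y -> level_drop x = 0 -> level_drop y != 0 ->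
  0 <= energy_density u level_lower (x, y) + level_err1 y x.
Proof.
move=> yx dx dy; rewrite err1_near//; last 2 first.
- by rewrite /nbh /= Dsym.
- exact: drop_upper.
have k1_0 := kern_ge0 D (m%:R + s) x y.
have La_ge0 := ltW La0.
apply: (@le_trans _ _ (La * `|level_drop x - level_drop y| * k1 x y)).
  by rewrite !mulr_ge0.
apply: le_trans (density_near (e := `|eta y - eta x| * w y) _) _.
  have := ler_wpM2l La_ge0 (overshoot_gain k (u y) (u x)
    (cutoff_range D o rho dd y) (cutoff_range D o rho dd x)).
  rewrite (distrC (eta y * _)) (distrC (u y)) (distrC (u y - _)) /level_lower /level_drop; lra.
have kS p : kern D p y x = kern D p x y by rewrite /kern Dsym.
have h := ler_wpM2r (overshoot_ge0 k (u y)) (cutoff_lip reg o rho dd0 y x).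
have := ler_wpM2l (mulr_ge0 (mulr_ge0 (ler0n R 2) La_ge0) k1_0) h.
by rewrite kS lerD2l -(kern_dist reg hs hm) (Dsym y x); lra.
Qed.

(** Far pairs carry no [level_low] because r <= dd. In a near pair with [y] outside [upper_set]
    nothing is dropped at [y], so the difference of the drops is the full drop at [x]. *)
Lemma low_le r z : r <= dd -> level_low r z <= energy_density u level_lower z + level_err z.
Proof.
case: z => x y rd; have La_ge0 := ltW La0.
have e1x := err1_ge0 x y; have e1y := err1_ge0 y x.
have [yx|nyx] := pselect (nbh D x dd y); last first.
  have nyr : ~ nbh D x r y by move=> yr; apply: nyx; exact: lt_le_trans yr rd.
  have -> : level_low r (x, y) = 0 by rewrite /level_low /= (indic_notin nyr) !mul0r mulr0.
  have nxy : ~ nbh D y dd x by rewrite /nbh /= Dsym.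
  have := density_far x y.
  rewrite /level_err /= (err1_far nyx) (err1_far nxy) /kern (Dsym y x); lra.
have [dx|dx] := eqVneq (level_drop x) 0.
  have -> : level_low r (x, y) = 0 by rewrite /level_low /= dx mulr0 mul0r.
  have [dy|dy] := eqVneq (level_drop y) 0; first by rewrite density_eq0// add0r err_ge0.
  by have := density_near2 yx dx dy; rewrite /level_err /=; lra.
have := density_near1 yx dx.
suff : level_low r (x, y) <= La * `|level_drop x - level_drop y| * k1 x y.
  by rewrite /level_err /=; lra.
have k1_0 := kern_ge0 D (m%:R + s) x y.
rewrite /level_low /=.
have [Ay|nAy] := pselect (A y).
  rewrite [X in _ * (_ * X * _)]indic_notin; last by apply.
  by rewrite mulr0 mul0r mulr0 mulr_ge0// mulr_ge0.
have -> : level_drop y = 0 by apply/eqP/negPn/negP => /drop_upper.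
rewrite subr0 (ger0_norm (drop_ge0 x)) ler_wpM2l ?(mulr_ge0 La_ge0 (drop_ge0 x))//.
by rewrite ler_piMl// mulr_ile1 ?indic_ge0 ?indic_le1.
Qed.

End lowering.

(** * Comparison of integrals of real functions *)

Section integral_comparison.
Context {R : realType} {d} {X : measurableType d}.
Variable mm : {measure set X -> \bar R}.
Implicit Types (Q : set X) (f e l : X -> R).
Local Open Scope ereal_scope.

Lemma ge0_le_integral_EFin Q f e : measurable Q ->
  measurable_fun Q f -> measurable_fun Q e ->
  (forall x, Q x -> 0 <= f x <= e x)%R ->
  \int[mm]_(x in Q) (f x)%:E <= \int[mm]_(x in Q) (e x)%:E.
Proof.
move=> mQ mf me fe; apply: ge0_le_integral => //.
- by move=> x /fe /andP[f0 _]; rewrite lee_fin.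
- exact/measurable_EFinP.
- exact/measurable_EFinP.
- by move=> x /fe /andP[_ ?]; rewrite lee_fin.
Qed.

Lemma ge0_integralZl_real Q f (a : R) : measurable Q -> measurable_fun Q f ->
  (forall x, Q x -> 0 <= f x)%R -> (0 <= a)%R ->
  \int[mm]_(x in Q) (a * f x)%:E = a%:E * \int[mm]_(x in Q) (f x)%:E.
Proof.
move=> mQ mf f0 a0; under eq_integral do rewrite EFinM.
by rewrite ge0_integralZl_EFin//; exact/measurable_EFinP.
Qed.

Lemma ge0_integralD_real Q f e : measurable Q ->
  measurable_fun Q f -> measurable_fun Q e ->
  (forall x, Q x -> 0 <= f x)%R -> (forall x, Q x -> 0 <= e x)%R ->
  \int[mm]_(x in Q) (f x + e x)%:E =
  \int[mm]_(x in Q) (f x)%:E + \int[mm]_(x in Q) (e x)%:E.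
Proof.
move=> mQ mf me f0 e0; under eq_integral do rewrite EFinD.
by rewrite ge0_integralD//; first [exact/measurable_EFinP
  | move=> x /f0; rewrite lee_fin | move=> x /e0; rewrite lee_fin].
Qed.

(* [f] need not be integrable: its integral is nonpositive and its negative
   part is controlled by [e]. *)
Lemma integral_le_double Q f e l : measurable Q ->
  measurable_fun Q f -> measurable_fun Q e -> measurable_fun Q l ->
  (forall x, Q x -> 0 <= e x)%R -> (forall x, Q x -> 0 <= l x <= f x + e x)%R ->
  \int[mm]_(x in Q) (f x)%:E <= 0 -> \int[mm]_(x in Q) (e x)%:E < +oo ->
  \int[mm]_(x in Q) (l x)%:E <=
  \int[mm]_(x in Q) (e x)%:E + \int[mm]_(x in Q) (e x)%:E.
Proof.
move=> mQ mf me ml e0 lfe f_le0 e_fin.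
have neg_le : \int[mm]_(x in Q) (f^\- x)%:E <= \int[mm]_(x in Q) (e x)%:E.
  apply: ge0_le_integral_EFin => //; first exact: measurable_funrneg.
  move=> x Qx; have /andP[l0 lx] := lfe x Qx; have := e0 x Qx => ex.
  rewrite /funrneg ge_max ex le_max lexx orbT /= andbT; lra.
have pos_le : \int[mm]_(x in Q) (f^\+ x)%:E <= \int[mm]_(x in Q) (e x)%:E.
  apply: le_trans neg_le.
  move: f_le0; rewrite integralE.
  under eq_integral do rewrite funeposE -EFin_max -/(funrpos f _).
  under [X in _ - X]eq_integral do rewrite funenegE -EFinN -EFin_max -/(funrneg f _).
  rewrite lee_subel_addr ?add0e//.
apply: (@le_trans _ _ (\int[mm]_(x in Q) (f^\+ x + e x)%:E)).
  apply: ge0_le_integral_EFin => //.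
    by apply: measurable_funD => //; exact: measurable_funrpos.
  move=> x Qx; have /andP[-> lx] /= := lfe x Qx.
  by apply: le_trans lx _; rewrite lerD2r /funrpos le_max lexx.
rewrite ge0_integralD_real//; first by rewrite leeD2r.
exact: measurable_funrpos.
Qed.

End integral_comparison.

(** * Restricted integrals, and vanishing from geometric decay *)

Section restricted_integral.
Context {R : realType} {d} {X : measurableType d}.
Variable mm : {measure set X -> \bar R}.

Lemma integral_indicl (B : set X) (f : X -> R) :
  (\int[mm]_(x in B) (f x)%:E = \int[mm]_x (\1_B x * f x)%:E)%E.
Proof.
rewrite integral_mkcond; apply: eq_integral => x _.
by rewrite /patch indicE; case: ifPn => _; rewrite ?mul1r ?mul0r.
Qed.

Lemma integral_eq0_of_geometric (Q : set X) (f : X -> R) (K q : R) :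
  measurable Q -> measurable_fun Q f ->
  (forall x, Q x -> 0 <= f x) -> 0 <= q <= 2^-1 -> 0 <= K ->
  (forall j : nat, (\int[mm]_(x in Q) (f x)%:E <= (q ^+ j * K)%:E)%E) ->
  \forall x \ae mm, Q x -> f x = 0.
Proof.
move=> mQ mf f0 /andP[q0 q1] K_ge0 fK.
have I0 : (\int[mm]_(x in Q) (f x)%:E = 0)%E.
  apply/eqP; rewrite eq_le; apply/andP; split; last first.
    by apply: integral_ge0 => x Qx; rewrite lee_fin f0.
  apply/lee_addgt0Pr => e e0; rewrite add0e.
  (* As q <= 1/2 and N < 2^N, the bound q^N K drops below [e] once N exceeds K / e. *)
  apply: le_trans (fK (Num.bound (K / e))) _; rewrite lee_fin.
  set N := Num.bound _.
  have qN : q ^+ N <= (2 ^+ N)^-1 by rewrite -exprVn lerXn2r ?nnegrE// invr_ge0.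
  apply: le_trans (ler_wpM2r K_ge0 qN) _.
  rewrite ler_pdivrMl ?exprn_gt0// -ler_pdivrMr//.
  apply/ltW/(lt_le_trans (archi_boundP (divr_ge0 K_ge0 (ltW e0)))).
  by rewrite -natrX ler_nat ltnW// ltn_expl.
have /ae_eq_integral_abs : measurable_fun Q (EFin \o f) by exact/measurable_EFinP.
move=> /(_ mm mQ)[+ _].
have -> : (\int[mm]_(x in Q) `|(EFin \o f) x| = \int[mm]_(x in Q) (f x)%:E)%E.
  by apply: eq_integral => x; rewrite inE => Qx /=; rewrite ger0_norm// f0.
move=> /(_ I0); apply: filterS => x H Qx.
by have := H Qx; rewrite /= => -[].
Qed.

End restricted_integral.

(** * Measurability of inner integrals *)

Section inner_integral.
Context {R : realType} {d} {T : measurableType d}.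
Variable mu : {sigma_finite_measure set T -> \bar R}.

(** The restriction to [Om] is moved into the integrand as an indicator, so that Tonelli's theorem
    on the whole product applies. *)
Lemma measurable_inner_integral (Om : set T) (F : T * T -> R) :
  measurable Om -> measurable_fun setT F -> (forall z, 0 <= F z) ->
  measurable_fun setT (fun x => \int[mu]_(y in Om) (F (x, y))%:E)%E.
Proof.
move=> mOm mF F0.
rewrite [X in measurable_fun _ X](_ : _ =
  fubini_F mu (fun z => (F z * \1_Om z.2)%:E)); last first.
  apply/funext => x; rewrite /fubini_F [LHS]integral_mkcond.
  apply: eq_integral => y _; rewrite /patch /= indicE.
  by case: ifPn => _; rewrite ?mulr1 ?mulr0.
apply: measurable_fun_fubini_tonelli_F => [|z].
  apply/measurable_EFinP/measurable_funM => //.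
  by apply: measurableT_comp => //; exact: measurable_indic.
by rewrite lee_fin mulr_ge0// indic_ge0.
Qed.

End inner_integral.

(** * Integrated bounds for the error and for the gain *)

Section lowering_integrals.
Context {R : realType} {d} {T : measurableType d}.
Variables (mu : {sigma_finite_measure set T -> \bar R}).
Variables (D : T -> T -> R) (m : nat) (cl cu : R).
Hypothesis reg : regular_space mu D m cl cu.
Variable s : R.
Hypothesis (hs : 0 < s < 1) (hm : (1 <= m)%N).
Local Notation k0 := (kern D (m%:R - 1 + s)).
Local Notation k1 := (kern D (m%:R + s)).
Variables (Phi : R -> R) (La c : R).
Hypotheses (La0 : 0 < La) (c_ge0 : 0 <= c).
Hypothesis Phi_cont : continuous Phi.
Hypothesis Phi_lip : forall a b, `|Phi a - Phi b| <= La * `|a - b|.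
Hypothesis Phi_le : forall t, Phi t <= La * `|t|.
Hypothesis Phi_ge : forall t, La * `|t| - c <= Phi t.

Variables (o : T) (rho dd : R) (u : T -> R) (k : R).
Hypothesis dd0 : 0 < dd.
Hypothesis mu_u : measurable_fun setT u.
Local Notation eta := (cutoff D o rho dd).
Local Notation w x := (overshoot k (u x)).
Local Notation A := (upper_set D o rho dd u k).
Local Notation drop := (level_drop D o rho dd u k).
Local Notation lowered := (level_lower D o rho dd u k).
Local Notation density := (energy_density D m s Phi u lowered).
Local Notation err1 := (level_err1 D m s La c o rho dd u k).
Local Notation err := (level_err D m s La c o rho dd u k).
Local Notation low := (level_low D m s La o rho dd u k).
Local Notation K0 := (near_const m cu s).
Local Notation K1 := (far_const m cu s).

Lemma measurable_upper_set : measurable A.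
Proof.
apply: measurableI; last exact: measurable_nbh reg _ _.
have := measurable_fun_ltr (measurable_cst k) mu_u.
by move=> /(_ measurableT [set true] I); rewrite setTI.
Qed.

Lemma measurable_overshoot : measurable_fun setT (fun x => w x).
Proof.
apply: measurable_maxr => //; exact: measurable_funB.
Qed.

Lemma measurable_drop : measurable_fun setT drop.
Proof.
apply: measurable_funM; last exact: measurable_overshoot.
exact: measurable_cutoff reg _ _ _.
Qed.

Lemma measurable_lowered : measurable_fun setT lowered.
Proof. by apply: measurable_funB => //; exact: measurable_drop. Qed.

Let mfst (f : T -> R) : measurable_fun setT f ->
  measurable_fun [set: T * T] (fun z => f z.1).
Proof. by move=> mf; apply: measurableT_comp. Qed.

Let msnd (f : T -> R) : measurable_fun setT f ->
  measurable_fun [set: T * T] (fun z => f z.2).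
Proof. by move=> mf; apply: measurableT_comp. Qed.

Let mquot (v : T -> R) : measurable_fun setT v ->
  measurable_fun [set: T * T] (fun z => Phi ((v z.1 - v z.2) / D z.1 z.2)).
Proof.
move=> mv; apply: measurableT_comp; first exact: continuous_measurable_fun.
apply: measurable_funM; first by apply: measurable_funB; [exact: mfst|exact: msnd].
rewrite (_ : (fun _ => _) = (fun z => kern D 1 z.1 z.2)); last first.
  by apply/funext => z; rewrite /kern powRr1 ?(dist_ge0 reg).
exact: measurable_kern reg _.
Qed.

Lemma measurable_density : measurable_fun setT density.
Proof.
apply: measurable_funM; last exact: measurable_kern reg _.
by apply: measurable_funB; apply: mquot => //; exact: measurable_lowered.
Qed.

Let msnd_nbh r : measurable [set z : T * T | nbh D z.1 r z.2].
Proof.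
have mD : measurable_fun [set: T * T] (fun z => D z.2 z.1).
  rewrite (_ : (fun _ => _) = (fun z => D z.1 z.2)); first exact: dist_meas reg.
  by apply/funext => z; rewrite (dist_sym reg).
have := measurable_fun_ltr mD (measurable_cst r).
by move=> /(_ measurableT [set true] I); rewrite setTI.
Qed.

Lemma measurable_indic_nbh r :
  measurable_fun [set: T * T] (fun z => \1_(nbh D z.1 r) z.2 : R).
Proof. exact: (@measurable_indic _ _ R setT _ (msnd_nbh r)). Qed.

Lemma measurable_indic_nbhC r :
  measurable_fun [set: T * T] (fun z => \1_(~` nbh D z.1 r) z.2 : R).
Proof. exact: (@measurable_indic _ _ R setT _ (measurableC (msnd_nbh r))). Qed.

Lemma measurable_err1 : measurable_fun [set: T * T] (fun z => err1 z.1 z.2).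
Proof.
apply: measurable_funD; (apply: measurable_funM; last exact: measurable_kern reg _).
- apply: measurable_funM; first exact: measurable_indic_nbh.
  apply: (@mfst (fun x => \1_A x * (2 * La / dd * w x + c))).
  apply: measurable_funM; first exact/measurable_indic/measurable_upper_set.
  apply: measurable_funD => //; apply: measurable_funM => //.
  exact: measurable_overshoot.
- apply: measurable_funM; first exact: measurable_indic_nbhC.
  by apply: measurable_funM => //; apply: mfst; exact: measurable_drop.
Qed.

Lemma measurable_err : measurable_fun setT err.
Proof.
apply: measurable_funD; first exact: measurable_err1.
have ms : measurable_fun setT (fun z : T * T => (z.2, z.1)).
  exact: measurable_fun_pair.
exact: (measurableT_comp measurable_err1 ms).
Qed.

Lemma measurable_low r : measurable_fun setT (low r).
Proof.
apply: measurable_funM.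
  by apply: measurable_funM => //; apply: mfst; exact: measurable_drop.
apply: measurable_funM; last exact: measurable_kern reg _.
apply: measurable_funM; first exact: measurable_indic_nbh.
apply: (@msnd (\1_(~` A))); apply: measurable_indic.
exact/measurableC/measurable_upper_set.
Qed.

Lemma inner_err1 x :
  (\int[mu]_y (err1 x y)%:E <=
    ((\1_A x * (2 * La / dd * w x + c)) * (K0 * dd `^ (1 - s))
     + La * drop x * (K1 * dd `^ (- s)))%:E)%E.
Proof.
have La_ge0 := ltW La0.
have a0 : 0 <= \1_A x * (2 * La / dd * w x + c).
  rewrite mulr_ge0 ?indic_ge0// addr_ge0// !mulr_ge0 ?overshoot_ge0//.
  by rewrite invr_ge0 ltW.
have b0 : 0 <= La * drop x by rewrite mulr_ge0// drop_ge0.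
have -> : (fun y => (err1 x y)%:E) = (fun y =>
  (\1_A x * (2 * La / dd * w x + c) * (\1_(nbh D x dd) y * k0 x y)
   + La * drop x * (\1_(~` nbh D x dd) y * k1 x y))%:E).
  by apply/funext => y; rewrite /level_err1; congr (_%:E); ring.
have mk p := measurable_kern_r reg p x.
have mN : measurable (nbh D x dd) := measurable_nbh reg x dd.
have m0 : measurable_fun setT (fun y => \1_(nbh D x dd) y * k0 x y).
  by apply: measurable_funM => //; exact: measurable_indic.
have m1 : measurable_fun setT (fun y => \1_(~` nbh D x dd) y * k1 x y).
  by apply: measurable_funM => //; exact/measurable_indic/measurableC.
have n0 y : 0 <= \1_(nbh D x dd) y * k0 x y by rewrite mulr_ge0 ?indic_ge0 ?kern_ge0.
have n1 y : 0 <= \1_(~` nbh D x dd) y * k1 x y by rewrite mulr_ge0 ?indic_ge0 ?kern_ge0.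
rewrite ge0_integralD_real//; last 4 first.
- exact: measurable_funM.
- exact: measurable_funM.
- by move=> y _; rewrite mulr_ge0.
- by move=> y _; rewrite mulr_ge0.
rewrite !ge0_integralZl_real// EFinD !(EFinM (_ * _)%R (_ * _)%R).
apply: leeD; rewrite lee_wpmul2l ?lee_fin//.
  exact: (kern_near reg hs hm).
exact: (kern_far reg hs).
Qed.

(** [level_err] symmetrizes [level_err1]; the two orders of integration give each half the same
    bound, whence the factor 2. *)
Lemma integral_err :
  (\int[mu \x mu]_z (err z)%:E <=
    2%:E * (((2 * La * K0 + La * K1) * dd `^ (- s))%:E
              * \int[mu]_(x in nbh D o (rho + 2 * dd)) (w x)%:E
            + (c * K0 * dd `^ (1 - s))%:E * mu A))%E.
Proof.
have La_ge0 := ltW La0.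
set B := nbh D o _; set C1 := (_ * dd `^ (- s)); set C2 := _ * dd `^ (1 - s).
have K0_ge0 : 0 <= K0 := near_const_ge0 reg hs.
have K1_ge0 : 0 <= K1 := far_const_ge0 reg hs.
have C1_ge0 : 0 <= C1.
  apply: mulr_ge0 (powR_ge0 _ _); apply: addr_ge0; last exact: mulr_ge0.
  exact: mulr_ge0 (mulr_ge0 (ler0n R 2) La_ge0) K0_ge0.
have C2_ge0 : 0 <= C2 := mulr_ge0 (mulr_ge0 c_ge0 K0_ge0) (powR_ge0 _ _).
have e_ge0 := err1_ge0 D m s La0 c_ge0 o rho u k dd0.
pose e z := (err1 z.1 z.2)%:E.
have me : measurable_fun [set: T * T] e.
  by apply/measurable_EFinP; exact: measurable_err1.
have me' : measurable_fun [set: T * T] (fun z => (err1 z.2 z.1)%:E).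
  apply/measurable_EFinP.
  have ms : measurable_fun setT (fun z : T * T => (z.2, z.1)).
    exact: measurable_fun_pair.
  exact: (measurableT_comp measurable_err1 ms).
have mB : measurable B := measurable_nbh reg o _.
have mA := measurable_upper_set.
have mw := measurable_overshoot.
have half : (\int[mu]_x \int[mu]_y (err1 x y)%:E <=
    C1%:E * \int[mu]_(x in B) (w x)%:E + C2%:E * mu A)%E.
  have m1 : measurable_fun setT (fun x => \1_B x * w x).
    by apply: measurable_funM => //; exact: measurable_indic.
  have m2 : measurable_fun setT (\1_A : T -> R) by exact: measurable_indic.
  apply: (@le_trans _ _ (\int[mu]_x (C1 * (\1_B x * w x) + C2 * \1_A x)%:E)%E).
    apply: ge0_le_integral => //.
    - by move=> x _; apply: integral_ge0 => y _; rewrite lee_fin.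
    - apply: (@measurable_fun_fubini_tonelli_F _ _ _ _ _ mu e me) => z.
      by rewrite lee_fin.
    - by apply/measurable_EFinP/measurable_funD; exact: measurable_funM.
    - move=> x _; apply: le_trans (inner_err1 x) _; rewrite lee_fin.
      (* The factor [dd] won by integrating [k0] over the near ball cancels the 1/dd of the cutoff
         gradient. *)
      have ddE : dd `^ (1 - s) = dd * dd `^ (- s).
        rewrite powRD ?powRr1 ?ltW//.
        by rewrite (gt_eqF dd0) implybT.
      have dp0 : 0 <= dd `^ (- s) by exact: powR_ge0.
      have AB : \1_A x <= \1_B x :> R.
        have [Ax|nAx] := pselect (A x); last by rewrite (indic_notin nAx) indic_ge0.
        by rewrite (indic_in Ax) indic_in//; case: Ax.
      have dB : drop x <= \1_B x * w x.
        have [->|dx] := eqVneq (drop x) 0.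
          by rewrite mulr_ge0 ?indic_ge0 ?overshoot_ge0.
        have [_ Bx] := drop_upper dd0 dx.
        by rewrite indic_in// mul1r drop_le.
      have h1 := ler_wpM2r (overshoot_ge0 k (u x)) AB.
      have h2 := ler_wpM2l (mulr_ge0 (mulr_ge0 La_ge0 K1_ge0) dp0) dB.
      have h3 := ler_wpM2l (mulr_ge0 (mulr_ge0 (mulr_ge0 (ler0n R 2) La_ge0) K0_ge0) dp0) h1.
      have -> : \1_A x * (2 * La / dd * w x + c) * (K0 * dd `^ (1 - s)) =
          2 * La * K0 * dd `^ (- s) * (\1_A x * w x) + C2 * \1_A x.
        rewrite /C2 ddE; field; exact: lt0r_neq0.
      by rewrite /C1; lra.
  rewrite ge0_integralD_real//; last 4 first.
  - exact: measurable_funM.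
  - exact: measurable_funM.
  - move=> x _; apply: mulr_ge0 => //.
    by rewrite mulr_ge0 ?indic_ge0 ?overshoot_ge0.
  - by move=> x _; apply: mulr_ge0 => //; exact: indic_ge0.
  rewrite !ge0_integralZl_real//; try by
    move=> x _; rewrite ?mulr_ge0 ?indic_ge0 ?overshoot_ge0.
  by rewrite -integral_indicl integral_indic// setIT.
rewrite /level_err; under eq_integral do rewrite EFinD.
rewrite ge0_integralD//; last 2 first.
- by move=> z _; rewrite lee_fin.
- by move=> z _; rewrite lee_fin.
rewrite (@fubini_tonelli1 _ _ _ _ _ mu mu e)//; last by move=> z; rewrite lee_fin.
rewrite fubini_tonelli2//; last by move=> z; rewrite lee_fin.
rewrite (_ : 2%:E = 1%:E + 1%:E)%E//.
rewrite ge0_muleDl// ?lee_fin// !mul1e.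
by apply: leeD.
Qed.

(** Every ball of radius [r] has measure at least cl r^m, and [A] takes at most half of that. On the
    remaining part the kernel seen from a point of [A] is at least r^-(m+s), so integrating in the
    second variable yields a multiple of r^-s times the drop. *)
Lemma integral_low r : 0 < r -> (2%:E * mu A <= (cl * r ^+ m)%:E)%E ->
  ((La * (cl / 2) * r `^ (- s))%:E * \int[mu]_(x in nbh D o rho) (w x)%:E <=
    \int[mu \x mu]_z (low r z)%:E)%E.
Proof.
move=> r0 Ar; have La_ge0 := ltW La0; have cl_ge0 := ltW (cl_gt0 reg).
have mA := measurable_upper_set.
have l_ge0 := low_ge0 D m s La0 o rho dd u k r.
have mN x : measurable (nbh D x r) := measurable_nbh reg x r.
have mNA x : measurable (nbh D x r `&` ~` A).
  by apply: measurableI => //; exact: measurableC.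
have muNA x : ((cl / 2 * r ^+ m)%:E <= mu (nbh D x r `&` ~` A))%E.
  have h : ((cl * r ^+ m)%:E <= mu (nbh D x r `&` ~` A) + mu A)%E.
    apply: le_trans (ball_ge reg x r0) _.
    apply: le_trans (measureU2 mu (mNA x) mA).
    apply: le_measure; rewrite ?inE//; first exact: measurableU.
    by move=> y Ny; have [Ay|nAy] := pselect (A y); [right|left].
  have Afin : mu A \is a fin_num.
    rewrite ge0_fin_numE//; apply: (@le_lt_trans _ _ (2%:E * mu A)%E).
      by rewrite lee_pemull// lee_fin ler1n.
    exact: le_lt_trans Ar (ltry _).
  move: Ar h; rewrite -(fineK Afin) -EFinM lee_fin => Ar h.
  have -> : cl / 2 * r ^+ m = cl * r ^+ m - cl * r ^+ m / 2 by field.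
  rewrite EFinB leeBlDr//; apply: le_trans h _.
  by rewrite leeD2l// lee_fin; lra.
rewrite (@fubini_tonelli1 _ _ _ _ _ mu mu (fun z => (low r z)%:E)); last 2 first.
- by apply/measurable_EFinP; exact: measurable_low.
- by move=> z; rewrite lee_fin.
set q := La * (cl / 2) * r `^ (- s).
have q0 : 0 <= q by rewrite !mulr_ge0 ?powR_ge0.
apply: (@le_trans _ _ (\int[mu]_x (q * drop x)%:E)%E).
  rewrite integral_indicl -ge0_integralZl_real//; last 2 first.
  - apply: measurable_funM; last exact: measurable_overshoot.
    exact/measurable_indic/(measurable_nbh reg).
  - by move=> x _; rewrite mulr_ge0 ?indic_ge0 ?overshoot_ge0.
  apply: ge0_le_integral_EFin => //.
  - apply: measurable_funM => //; apply: measurable_funM; last exact: measurable_overshoot.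
    exact/measurable_indic/(measurable_nbh reg).
  - by apply: measurable_funM => //; exact: measurable_drop.
  - move=> x _; apply/andP; split.
      by apply: mulr_ge0 => //; rewrite mulr_ge0 ?indic_ge0 ?overshoot_ge0.
    rewrite ler_wpM2l//.
    have [xr|xr] := pselect (nbh D o rho x).
      by rewrite (indic_in xr) /level_drop cutoff_eq1.
    by rewrite (indic_notin xr) mul0r drop_ge0.
apply: ge0_le_integral => //.
- by move=> x _; rewrite lee_fin mulr_ge0// drop_ge0.
- by apply/measurable_EFinP/measurable_funM => //; exact: measurable_drop.
- apply: (@measurable_fun_fubini_tonelli_F _ _ _ _ _ mu (fun z => (low r z)%:E)).
    by apply/measurable_EFinP; exact: measurable_low.
  by move=> z; rewrite lee_fin.
move=> x _; rewrite /fubini_F.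
have [dx|dx] := eqVneq (drop x) 0.
  by rewrite dx mulr0; apply: integral_ge0 => y _; rewrite lee_fin.
have Ax := drop_upper dd0 dx.
have dx0 := drop_ge0 D o rho dd u k x.
have mk := measurable_kern_r reg (m%:R + s) x.
have p0 : 0 <= La * drop x * (r `^ (m%:R + s))^-1.
  by apply: mulr_ge0; [exact: mulr_ge0|rewrite invr_ge0 powR_ge0].
apply: (@le_trans _ _
    (\int[mu]_y (La * drop x * (r `^ (m%:R + s))^-1 * \1_(nbh D x r `&` ~` A) y)%:E)%E).
  rewrite ge0_integralZl_real//.
  rewrite integral_indic// setIT.
  apply: (@le_trans _ _ ((La * drop x * (r `^ (m%:R + s))^-1)%:E * (cl / 2 * r ^+ m)%:E)%E).
    rewrite -EFinM lee_fin /q.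
    have -> : r `^ (- s) = r ^+ m / r `^ (m%:R + s).
      rewrite -powR_mulrn ?ltW// -powRN -powRD; last by rewrite (gt_eqF r0) implybT.
      by congr (_ `^ _); ring.
    by rewrite le_eqVlt; apply/orP; left; apply/eqP; ring.
  apply: lee_wpmul2l; last exact: muNA.
  by rewrite lee_fin.
apply: ge0_le_integral_EFin => //.
- by apply: measurable_funM => //; exact: measurable_indic.
- exact: (measurableT_comp (measurable_low r) (pair1_measurable x)).
move=> y _; rewrite mulr_ge0 ?indic_ge0//=.
rewrite /level_low /= -mulrA ler_wpM2l ?(mulr_ge0 La_ge0 dx0)//.
have [[Ny nAy]|h] := pselect ((nbh D x r `&` ~` A) y); last first.
  by rewrite (indic_notin h) mulr0 !mulr_ge0 ?indic_ge0 ?kern_ge0.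
rewrite (indic_in Ny) (indic_in nAy) (indic_in (conj Ny nAy : (nbh D x r `&` ~` A) y)).
(* [x] lies in [A] and [y] does not, so they differ. On the diagonal the kernel is 0 and the lower
   bound would fail. *)
have Dp : 0 < D x y.
  rewrite lt_def (dist_ge0 reg) andbT; apply/eqP => /(dist_eq0 reg) xy.
  by apply: nAy; rewrite -xy.
rewrite !mul1r mulr1 /kern lef_pV2 ?posrE ?powR_gt0//.
rewrite ge0_ler_powR ?nnegrE ?(dist_ge0 reg) ?(ltW r0)//.
  by rewrite addr_ge0// ltW//; case/andP: hs.
by apply: ltW; rewrite (dist_sym reg).
Qed.

End lowering_integrals.

(** * Subminimality in a metric measure space *)

Section variational.
Context {R : realType} {d} {T : measurableType d}.
Variables (mu : {sigma_finite_measure set T -> \bar R}).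
Variables (D : T -> T -> R) (m : nat) (s : R) (Phi : R -> R).

(** For the Euclidean distance and [calG g], the definitions of this section unfold to [Ws], [Qdom]
    and [subminimizer], and [nbh] at the origin to [eball]: the hypothesis on [u] transfers by
    conversion. *)
Definition Wspace (Om : set T) : set (T -> R) := [set v |
  [/\ measurable_fun setT v,
      mu.-integrable Om (EFin \o v) &
      (\int[mu]_(x in Om) \int[mu]_(y in Om)
         (`|v x - v y| / D x y `^ (m%:R + s))%:E < +oo)%E]].

Definition cross (Om : set T) : set (T * T) := ~` ((~` Om) `*` (~` Om)).

Definition subminimal (Om : set T) (u : T -> R) : Prop :=
  Wspace Om u /\
  forall v, Wspace Om v ->
    (\forall x \ae mu, ~ Om x -> v x = u x) ->
    (\forall x \ae mu, Om x -> v x <= u x) ->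
    (\int[mu \x mu]_(z in cross Om) (energy_density D m s Phi u v z)%:E <= 0)%E.

End variational.

(** * Admissibility of the competitor and the energy estimate *)

Section level_step.
Context {R : realType} {d} {T : measurableType d}.
Variables (mu : {sigma_finite_measure set T -> \bar R}).
Variables (D : T -> T -> R) (m : nat) (cl cu : R).
Hypothesis reg : regular_space mu D m cl cu.
Variable s : R.
Hypothesis (hs : 0 < s < 1) (hm : (1 <= m)%N).
Local Notation k0 := (kern D (m%:R - 1 + s)).
Local Notation k1 := (kern D (m%:R + s)).
Variables (Phi : R -> R) (La c : R).
Hypotheses (La0 : 0 < La) (c_ge0 : 0 <= c).
Hypothesis Phi_cont : continuous Phi.
Hypothesis Phi_lip : forall a b, `|Phi a - Phi b| <= La * `|a - b|.
Hypothesis Phi_le : forall t, Phi t <= La * `|t|.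
Hypothesis Phi_ge : forall t, La * `|t| - c <= Phi t.

Variables (o : T) (R2 : R) (u : T -> R).
Hypothesis R2_gt0 : 0 < R2.
Local Notation Om := (nbh D o R2).
Hypothesis Wu : Wspace mu D m s Om u.

Variables (rho dd k : R).
Hypothesis dd0 : 0 < dd.
Hypothesis rdR : rho + 2 * dd <= R2.
Local Notation eta := (cutoff D o rho dd).
Local Notation w x := (overshoot k (u x)).
Local Notation A := (upper_set D o rho dd u k).
Local Notation drop := (level_drop D o rho dd u k).
Local Notation lowered := (level_lower D o rho dd u k).
Local Notation density := (energy_density D m s Phi u lowered).
Local Notation err := (level_err D m s La c o rho dd u k).
Local Notation low := (level_low D m s La o rho dd u k).
Local Notation K0 := (near_const m cu s).
Local Notation K1 := (far_const m cu s).

Let mu_u : measurable_fun setT u. Proof. by case: Wu. Qed.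
Let mOm : measurable Om := measurable_nbh reg o R2.

Let Om_fin : (mu Om < +oo)%E.
Proof. exact: le_lt_trans (ball_le reg o R2_gt0) (ltry _). Qed.

Let mw : measurable_fun setT (fun x => w x) := measurable_overshoot k mu_u.

Lemma integrable_overshoot : mu.-integrable Om (fun x => (w x)%:E).
Proof.
have iu : mu.-integrable Om (EFin \o u) by case: Wu.
have ik : mu.-integrable Om (EFin \o cst `|k|).
  apply/integrableP; split; first exact/measurable_EFinP/measurable_cst.
  rewrite (_ : (fun x => _) = cst (`| `|k|%:E |)%E)// integral_cst//.
  by rewrite lte_mul_pinfty.
apply: (le_integrable mOm _ _ (integrableD mOm (integrable_norm iu) ik)).
  by apply/measurable_EFinP; apply: measurable_funS mw.
move=> x _; rewrite [leRHS](_ : _ = (`| `|u x| + `|k| |)%:E)// lee_fin.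
rewrite (ger0_norm (overshoot_ge0 _ _)).
rewrite (le_trans _ (ler_norm _))// /overshoot ge_max.
rewrite addr_ge0// andbT lerD// ?ler_norm//.
by rewrite -normrN ler_norm.
Qed.

Lemma overshoot_fin (r : R) : r <= R2 ->
  (\int[mu]_(x in nbh D o r) (w x)%:E < +oo)%E.
Proof.
move=> rR; apply: (@le_lt_trans _ _ (\int[mu]_(x in Om) (w x)%:E)%E).
  apply: ge0_subset_integral => //; first exact: measurable_nbh reg _ _.
  - by apply/measurable_EFinP; apply: measurable_funS mw.
  - by move=> x _; rewrite lee_fin overshoot_ge0.
  - by move=> x /=; rewrite /nbh /= => xr; exact: lt_le_trans xr rR.
have /integrableP[_] := integrable_overshoot.
apply: le_lt_trans; apply: ge0_le_integral => //.
- by move=> x _; rewrite lee_fin overshoot_ge0.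
- by apply/measurable_EFinP; apply: measurable_funS mw.
- by apply: measurableT_comp => //; apply/measurable_EFinP; apply: measurable_funS mw.
- by move=> x _; rewrite lee_fin ler_norm.
Qed.

Lemma upper_set_fin : (mu A < +oo)%E.
Proof.
apply: le_lt_trans Om_fin; apply: le_measure; rewrite ?inE//.
  exact: (measurable_upper_set reg).
by move=> x [_]; rewrite /nbh /= => xr; exact: lt_le_trans xr rdR.
Qed.

Lemma drop_out x : ~ Om x -> drop x = 0.
Proof.
move=> xO; apply/eqP/negPn/negP => /(drop_upper dd0)[_] xr; apply: xO.
exact: lt_le_trans xr rdR.
Qed.

(** The reason why the competitor has finite seminorm: the cutoff varies by at most D x y / dd near
    [x] and by at most 1 elsewhere, so integrating the last term in [y] costs only a multiple of
    [w x]. *)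
Let lowered_diff x y : `|lowered x - lowered y| * k1 x y <=
  2 * (`|u x - u y| * k1 x y)
  + w x * (dd^-1 * (\1_(nbh D x dd) y * k0 x y) + \1_(~` nbh D x dd) y * k1 x y).
Proof.
have k1_0 := kern_ge0 D (m%:R + s) x y.
have w0 := overshoot_ge0 k (u x).
have /andP[ex0 ex1] := cutoff_range D o rho dd x.
have /andP[ey0 ey1] := cutoff_range D o rho dd y.
have h1 : `|lowered x - lowered y| <= 2 * `|u x - u y| + `|eta x - eta y| * w x.
  have -> : lowered x - lowered y =
      (u x - u y) - (eta y * (w x - w y) + (eta x - eta y) * w x).
    by rewrite /level_lower /level_drop; ring.
  apply: (le_trans (ler_normB _ _)).
  have h := ler_normD (eta y * (w x - w y)) ((eta x - eta y) * w x).
  rewrite !normrM (ger0_norm w0) (ger0_norm ey0) in h.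
  have h2 : eta y * `|w x - w y| <= `|u x - u y|.
    by apply: le_trans (overshoot_lip k _ _); rewrite ler_piMl.
  lra.
have h2 : `|eta x - eta y| * k1 x y <=
    dd^-1 * (\1_(nbh D x dd) y * k0 x y) + \1_(~` nbh D x dd) y * k1 x y.
  have [yx|yx] := pselect (nbh D x dd y).
    rewrite (indic_in yx) indic_notin; last by apply.
    have := ler_wpM2r k1_0 (cutoff_lip reg o rho dd0 x y).
    rewrite mul1r mul0r addr0 -(kern_dist reg hs hm); lra.
  rewrite (indic_notin yx) (indic_in (S := ~` nbh D x dd))// mul0r mulr0 add0r mul1r.
  rewrite ler_piMl// ler_norml; apply/andP; split; lra.
have h3 := ler_wpM2r k1_0 h1; have h4 := ler_wpM2l w0 h2.
lra.
Qed.

Lemma lowered_Wspace : Wspace mu D m s Om lowered.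
Proof.
have ml : measurable_fun setT lowered := measurable_lowered reg o rho dd k mu_u.
case: Wu => _ iu du; split; first exact: ml.
  have -> : EFin \o lowered = (fun x => (u x)%:E - (drop x)%:E)%E.
    by apply/funext => x /=; rewrite -EFinB.
  apply: integrableB => //.
  apply: (le_integrable mOm _ _ integrable_overshoot).
    apply/measurable_EFinP; apply: measurable_funS (measurable_drop reg o rho dd k mu_u) => //.
  move=> x _ /=; rewrite lee_fin !ger0_norm ?overshoot_ge0 ?drop_ge0//.
  exact: drop_le.
pose I1 x := (\int[mu]_(y in Om) (`|u x - u y| * k1 x y)%:E)%E.
pose C := dd^-1 * (K0 * dd `^ (1 - s)) + K1 * dd `^ (- s).
have mF (v : T -> R) : measurable_fun setT v ->
    measurable_fun [set: T * T] (fun z => `|v z.1 - v z.2| * k1 z.1 z.2).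
  move=> mv; apply: measurable_funM; last exact: measurable_kern reg _.
  apply: measurableT_comp => //; apply: measurable_funB;
    by apply: measurableT_comp.
have F0 (v : T -> R) z : 0 <= `|v z.1 - v z.2| * k1 z.1 z.2.
  by rewrite mulr_ge0 ?kern_ge0.
have mI (v : T -> R) (mv : measurable_fun setT v) :=
  measurable_inner_integral mu mOm (mF v mv) (F0 v).
have K0_ge0 : 0 <= K0 := near_const_ge0 reg hs.
have K1_ge0 : 0 <= K1 := far_const_ge0 reg hs.
have ddV : 0 <= dd^-1 by rewrite invr_ge0 ltW.
have C_ge0 : 0 <= C.
  apply: addr_ge0; last exact: mulr_ge0 K1_ge0 (powR_ge0 _ _).
  exact: mulr_ge0 ddV (mulr_ge0 K0_ge0 (powR_ge0 _ _)).
have I1_ge0 x : (0 <= I1 x)%E.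
  by apply: integral_ge0 => y _; rewrite lee_fin (F0 u (x, y)).
have mw1 : measurable_fun Om (fun x => (C * w x)%:E).
  by apply/measurable_EFinP/measurable_funM => //; apply: measurable_funS mw.
have mI1 : measurable_fun Om (fun x => 2%:E * I1 x)%E.
  by apply: measurable_funeM; apply: measurable_funS (mI u mu_u).
apply: (@le_lt_trans _ _ (\int[mu]_(x in Om) (2%:E * I1 x + (C * w x)%:E))%E); last first.
  rewrite ge0_integralD//; last 2 first.
  - by move=> x _; rewrite mule_ge0.
  - by move=> x _; rewrite lee_fin mulr_ge0// overshoot_ge0.
  rewrite ge0_integralZl//; last by apply: measurable_funS (mI u mu_u).
  rewrite ge0_integralZl_real//; last 2 first.
  - by apply: measurable_funS mw.
  - by move=> x _; exact: overshoot_ge0.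
  apply: lte_add_pinfty; first by rewrite lte_mul_pinfty.
  by rewrite lte_mul_pinfty// (overshoot_fin (lexx R2)).
apply: ge0_le_integral => //.
- by move=> x _; apply: integral_ge0 => y _; rewrite lee_fin (F0 lowered (x, y)).
- by apply: measurable_funS (mI _ ml).
- exact: emeasurable_funD.
move=> x _; rewrite /I1.
have mk p := measurable_kern_r reg p x.
have mN : measurable (nbh D x dd) := measurable_nbh reg x dd.
have m0 : measurable_fun setT (fun y => \1_(nbh D x dd) y * k0 x y).
  by apply: measurable_funM => //; exact: measurable_indic.
have m1 : measurable_fun setT (fun y => \1_(~` nbh D x dd) y * k1 x y).
  by apply: measurable_funM => //; exact/measurable_indic/measurableC.
have n0 y : 0 <= \1_(nbh D x dd) y * k0 x y by rewrite mulr_ge0 ?indic_ge0 ?kern_ge0.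
have n1 y : 0 <= \1_(~` nbh D x dd) y * k1 x y by rewrite mulr_ge0 ?indic_ge0 ?kern_ge0.
pose H y := dd^-1 * (\1_(nbh D x dd) y * k0 x y) + \1_(~` nbh D x dd) y * k1 x y.
have H0 y : 0 <= H y by rewrite addr_ge0// mulr_ge0.
have mH : measurable_fun setT H by apply: measurable_funD => //; exact: measurable_funM.
have intH : (\int[mu]_(y in Om) (H y)%:E <= C%:E)%E.
  apply: (@le_trans _ _ (\int[mu]_y (H y)%:E)%E).
    apply: ge0_subset_integral => //; first exact/measurable_EFinP.
    by move=> y _; rewrite lee_fin.
  rewrite ge0_integralD_real//; last 2 first.
  - exact: measurable_funM.
  - by move=> y _; rewrite mulr_ge0.
  rewrite ge0_integralZl_real// /C EFinD EFinM; apply: leeD.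
    by rewrite lee_wpmul2l ?lee_fin//; exact: (kern_near reg hs hm).
  exact: (kern_far reg hs).
have mFx : measurable_fun Om (fun y => `|u x - u y| * k1 x y).
  apply: measurable_funS (measurableT_comp (mF u mu_u) (pair1_measurable x)) => //.
have mHx : measurable_fun Om H by apply: measurable_funS mH.
apply: (@le_trans _ _ (\int[mu]_(y in Om)
    (2 * (`|u x - u y| * k1 x y) + w x * H y)%:E)%E).
  apply: ge0_le_integral_EFin => //.
  - by apply: measurable_funS (measurableT_comp (mF _ ml) (pair1_measurable x)).
  - by apply: measurable_funD; exact: measurable_funM.
  - by move=> y _; rewrite (F0 lowered (x, y)) lowered_diff.
rewrite ge0_integralD_real//; last 4 first.
- exact: measurable_funM.
- exact: measurable_funM.
- by move=> y _; rewrite mulr_ge0// (F0 u (x, y)).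
- by move=> y _; rewrite mulr_ge0// overshoot_ge0.
rewrite !ge0_integralZl_real//; last 2 first.
- exact: overshoot_ge0.
- by move=> y _; rewrite (F0 u (x, y)).
rewrite leeD2l// (mulrC C) EFinM lee_wpmul2l// lee_fin overshoot_ge0//.
Qed.

Hypothesis sub_u : subminimal mu D m s Phi Om u.

Let mQ : measurable (cross Om).
Proof. by apply: measurableC; apply: measurableX; exact: measurableC. Qed.

(** Testing with [level_lower] makes the integral of [density] nonpositive, so [low_le] bounds the
    gain by twice the error; the factor 2 of [integral_err] makes it 4. *)
Lemma level_step r : 0 < r <= dd -> (2%:E * mu A <= (cl * r ^+ m)%:E)%E ->
  ((La * (cl / 2) * r `^ (- s))%:E * \int[mu]_(x in nbh D o rho) (w x)%:E <=
    4%:E * (((2 * La * K0 + La * K1) * dd `^ (- s))%:E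
              * \int[mu]_(x in nbh D o (rho + 2 * dd)) (w x)%:E
            + (c * K0 * dd `^ (1 - s))%:E * mu A))%E.
Proof.
move=> /andP[r0 rd] Ar.
apply: le_trans (integral_low reg hs La0 dd0 mu_u r0 Ar) _.
set B := (X in (_ <= 4%:E * X)%E).
have errB : (\int[mu \x mu]_z (err z)%:E <= 2%:E * B)%E.
  exact: (integral_err reg hs hm La0 c_ge0 o rho k dd0 mu_u).
have me := measurable_err reg s La c o rho dd k mu_u.
have e_ge0 := err_ge0 D m s La0 c_ge0 o rho u k dd0.
have l_ge0 := low_ge0 D m s La0 o rho dd u k r.
have ml := measurable_low reg s La o rho dd k mu_u r.
have Bfin : (B < +oo)%E.
  have K0_ge0 : 0 <= K0 := near_const_ge0 reg hs.
  have K1_ge0 : 0 <= K1 := far_const_ge0 reg hs.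
  apply: lte_add_pinfty; apply: lte_mul_pinfty => //.
  - rewrite lee_fin; apply: mulr_ge0 (powR_ge0 _ _).
    have La_ge0 := ltW La0.
    by apply: addr_ge0; apply: mulr_ge0 => //; exact: mulr_ge0.
  - exact: overshoot_fin.
  - by rewrite lee_fin; apply: mulr_ge0 (powR_ge0 _ _); exact: mulr_ge0.
  - exact: upper_set_fin.
have errQ : (\int[mu \x mu]_(z in cross Om) (err z)%:E <= 2%:E * B)%E.
  apply: le_trans errB; apply: ge0_subset_integral => //.
    exact/measurable_EFinP.
  by move=> z _; rewrite lee_fin.
(* A pair outside [cross Om] has its first point outside [Om], where nothing is dropped. *)
have -> : (\int[mu \x mu]_z (low r z)%:E =
    \int[mu \x mu]_(z in cross Om) (low r z)%:E)%E.
  rewrite [RHS]integral_mkcond; apply: eq_integral => z _; rewrite /patch.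
  case: ifPn => //; rewrite notin_setE /cross /= => /contrapT[z1 _].
  by rewrite /level_low (drop_out z1) mulr0 mul0r.
have density_le0 : (\int[mu \x mu]_(z in cross Om) (density z)%:E <= 0)%E.
  case: sub_u => _; apply; first exact: lowered_Wspace.
    by apply: aeW => x xO; rewrite /level_lower drop_out// subr0.
  by apply: aeW => x _; rewrite /level_lower gerBl drop_ge0.
apply: le_trans (integral_le_double (mm := (mu \x mu)%E) mQ _ _ _ _ _ density_le0 _) _.
- exact: measurable_funS (measurable_density reg s Phi_cont o rho dd k mu_u).
- exact: measurable_funS me.
- exact: measurable_funS ml.
- by move=> z _.
- move=> z _; rewrite l_ge0/=.
  exact: (low_le reg hs hm La0 c_ge0 Phi_lip Phi_le Phi_ge o rho u k dd0 z rd).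
- by apply: le_lt_trans errQ _; rewrite lte_mul_pinfty.
apply: le_trans (leeD errQ errQ) _.
have -> : 4%:E = (2%:E + 2%:E)%E :> \bar R by rewrite -EFinD; congr (_%:E); ring.
by rewrite ge0_muleDl// ?lee_fin//.
Qed.

End level_step.

(** * The De Giorgi iteration *)

Section iteration.
Context {R : realType} {d} {T : measurableType d}.
Variables (mu : {sigma_finite_measure set T -> \bar R}).
Variables (D : T -> T -> R) (m : nat) (cl cu : R).
Hypothesis reg : regular_space mu D m cl cu.
Variable s : R.
Hypothesis (hs : 0 < s < 1) (hm : (1 <= m)%N).
Variables (Phi : R -> R) (La c : R).
Hypotheses (La0 : 0 < La) (c_ge0 : 0 <= c).
Hypothesis Phi_cont : continuous Phi.
Hypothesis Phi_lip : forall a b, `|Phi a - Phi b| <= La * `|a - b|.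
Hypothesis Phi_le : forall t, Phi t <= La * `|t|.
Hypothesis Phi_ge : forall t, La * `|t| - c <= Phi t.
Local Notation K0 := (near_const m cu s).
Local Notation K1 := (far_const m cu s).

Lemma exists_small_powR (C0 theta : R) : 0 <= C0 -> 0 < theta < 1 ->
  exists2 b, 0 < b <= 1 & C0 * b `^ s <= theta.
Proof.
move: hs => /andP[s0 _] C00 /andP[t0 t1].
have C1 : 0 < C0 + 1 by rewrite ltr_wpDl.
(* [C0 + 1] keeps the quotient meaningful for C0 = 0 and below 1 in all cases. *)
exists ((theta / (C0 + 1)) `^ s^-1).
  rewrite powR_gt0 ?divr_gt0//=.
  have E1 : 1 = 1 `^ s^-1 :> R by rewrite powR1.
  rewrite [leRHS]E1 ge0_ler_powR ?nnegrE ?invr_ge0 ?divr_ge0 ?ltW//.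
  rewrite ltr_pdivrMr//; lra.
rewrite -powRrM mulVf ?gt_eqF// powRr1 ?(divr_ge0 (ltW t0) (ltW C1))//.
by rewrite mulrCA ler_piMr ?(ltW t0)// ler_pdivrMr// mul1r lerDl.
Qed.

Let M0 : R := 2 * La * K0 + La * K1 + c * K0.

Let K0_ge0 : 0 <= K0 := near_const_ge0 reg hs.
Let K1_ge0 : 0 <= K1 := far_const_ge0 reg hs.

Let M0_ge0 : 0 <= M0.
Proof.
have La_ge0 := ltW La0.
by apply: addr_ge0; [apply: addr_ge0|]; rewrite ?(mulr_ge0 _ K0_ge0) ?(mulr_ge0 _ K1_ge0) ?mulr_ge0.
Qed.

(** Chebyshev between the levels [k] and [k'] gives (k' - k) |A| <= y. The last assumption turns
    this into the half-ball condition at radius b dd, and dd <= k' - k into dd |A| <= y, which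
    absorbs the measure term of [level_step]. The ratio of dd^-s to (b dd)^-s is the gain b^s; the 8
    is the 4 of [level_step] divided by the 1/2 of the half-ball. *)
Lemma iteration_step (o : T) (R2 rho dd k k' y b : R) (u : T -> R) :
  0 < R2 -> 0 < dd -> rho + 2 * dd <= R2 -> dd <= k' - k -> 0 < b <= 1 -> 0 <= y ->
  subminimal mu D m s Phi (nbh D o R2) u ->
  (\int[mu]_(x in nbh D o (rho + 2 * dd)) (overshoot k (u x))%:E <= y%:E)%E ->
  2 * y <= (k' - k) * (cl * (b * dd) ^+ m) ->
  (\int[mu]_(x in nbh D o rho) (overshoot k' (u x))%:E <=
    (8 * M0 / (La * cl) * b `^ s * y)%:E)%E.
Proof.
move=> R20 dd0 rdR kk /andP[b0 b1] y0 sub_u Yy ym.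
have cl0 := cl_gt0 reg.
have Wu : Wspace mu D m s (nbh D o R2) u by case: sub_u.
have mu_u : measurable_fun setT u by case: Wu.
have kk0 : 0 < k' - k by exact: lt_le_trans kk.
have mB := measurable_nbh reg o (rho + 2 * dd).
have mA := measurable_upper_set reg o rho dd k' mu_u.
set A := upper_set D o rho dd u k' in mA.
have mwB j : measurable_fun (nbh D o (rho + 2 * dd)) (fun x => overshoot j (u x)).
  exact: measurable_funS (measurable_overshoot j mu_u).
have Ay : ((k' - k)%:E * mu A <= y%:E)%E.
  apply: le_trans Yy; rewrite integral_indicl.
  have -> : mu A = (\int[mu]_x (\1_A x)%:E)%E by rewrite integral_indic// setIT.
  rewrite -ge0_integralZl_real//; last exact: ltW.
  apply: ge0_le_integral_EFin => //.
  - by apply: measurable_funM => //; exact: measurable_indic.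
  - by apply: measurable_funM;
      [exact: measurable_indic|exact: measurable_overshoot].
  move=> x _; rewrite mulr_ge0 ?indic_ge0 ?(ltW kk0)//=.
  have [[ku xB]|nAx] := pselect (A x); last first.
    by rewrite (indic_notin nAx) mulr0 mulr_ge0 ?indic_ge0 ?overshoot_ge0.
  rewrite (indic_in (conj ku xB : A x)) (indic_in xB) mulr1 mul1r.
  by rewrite /overshoot le_max; apply/orP; left; move: ku => /=; lra.
have Afin : mu A \is a fin_num.
  by rewrite ge0_fin_numE//; exact: (upper_set_fin reg R20 Wu _ rdR).
have Yy' : (\int[mu]_(x in nbh D o (rho + 2 * dd)) (overshoot k' (u x))%:E <= y%:E)%E.
  apply: le_trans Yy; apply: ge0_le_integral_EFin => // x _.
  rewrite overshoot_ge0/= /overshoot.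
  rewrite ge_max le_max; apply/andP; split; first by apply/orP; left; lra.
  by rewrite le_max lexx orbT.
have r0 : 0 < b * dd by rewrite mulr_gt0.
have rd : 0 < b * dd <= dd by rewrite r0/= ler_piMl// ltW.
have Ar : (2%:E * mu A <= (cl * (b * dd) ^+ m)%:E)%E.
  move: Ay; rewrite -(fineK Afin) -!EFinM !lee_fin => Ay.
  rewrite -(ler_pM2l kk0) mulrCA; apply: le_trans ym.
  by rewrite ler_pM2l.
have := level_step reg hs hm La0 c_ge0 Phi_cont Phi_lip Phi_le Phi_ge
  R20 Wu dd0 rdR sub_u rd Ar.
have Y'fin : (\int[mu]_(x in nbh D o rho) (overshoot k' (u x))%:E)%E \is a fin_num.
  rewrite ge0_fin_numE; last first.
    by apply: integral_ge0 => x _; rewrite lee_fin overshoot_ge0.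
  by apply: (overshoot_fin reg R20 Wu); lra.
have Yfin : (\int[mu]_(x in nbh D o (rho + 2 * dd)) (overshoot k' (u x))%:E)%E \is a fin_num.
  rewrite ge0_fin_numE; last first.
    by apply: integral_ge0 => x _; rewrite lee_fin overshoot_ge0.
  by apply: (overshoot_fin reg R20 Wu).
move: Yy' Ay; rewrite -(fineK Afin) -(fineK Y'fin) -(fineK Yfin).
set a' := fine (mu A); set Y := fine (integral _ _ _); set Y' := fine (integral _ _ _).
rewrite -!EFinM !lee_fin => Yy' Ay H.
have q0 : 0 < dd `^ (- s) by rewrite powR_gt0.
have a'0 : 0 <= a' by rewrite fine_ge0.
have h1 : dd * a' <= y by apply: le_trans Ay; rewrite ler_wpM2r.
have ddE : dd `^ (1 - s) = dd * dd `^ (- s).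
  by rewrite powRD ?powRr1 ?(ltW dd0)// (gt_eqF dd0) implybT.
have rE : (b * dd) `^ (- s) = (b `^ s)^-1 * dd `^ (- s).
  by rewrite powRM ?(ltW b0) ?(ltW dd0)// powRN.
have bs0 : 0 < b `^ s by rewrite powR_gt0.
have La_ge0 := ltW La0.
have h2 : (2 * La * K0 + La * K1) * dd `^ (- s) * Y + c * K0 * dd `^ (1 - s) * a' <=
    M0 * y * dd `^ (- s).
  have c1 : 0 <= (2 * La * K0 + La * K1) * dd `^ (- s).
    apply: mulr_ge0 (ltW q0).
    by apply: addr_ge0; apply: mulr_ge0 => //; exact: mulr_ge0.
  have c2 : 0 <= c * K0 * dd `^ (- s) by apply: mulr_ge0 (ltW q0); exact: mulr_ge0.
  have := ler_wpM2l c1 Yy'; have := ler_wpM2l c2 h1.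
  by rewrite ddE /M0; lra.
have h3 : La * (cl / 2) * ((b `^ s)^-1 * dd `^ (- s)) * Y' <= 4 * (M0 * y * dd `^ (- s)).
  by rewrite -rE; apply: le_trans H _; rewrite ler_pM2l.
have h4 : La * (cl / 2) * (b `^ s)^-1 * Y' <= 4 * (M0 * y).
  by rewrite -(ler_pM2r q0); apply: le_trans (le_trans _ h3) _; rewrite le_eqVlt;
    apply/orP; left; apply/eqP; ring.
have -> : 8 * M0 / (La * cl) * b `^ s * y = (2 * b `^ s / (La * cl)) * (4 * (M0 * y)).
  by field; rewrite !gt_eqF.
have p0 : 0 <= 2 * b `^ s / (La * cl).
  by rewrite divr_ge0 ?mulr_ge0// ltW.
have := ler_wpM2l p0 h4.
have -> // : 2 * b `^ s / (La * cl) * (La * (cl / 2) * (b `^ s)^-1 * Y') = Y'.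
by field; rewrite !gt_eqF.
Qed.


(** From one step to the next the level increment halves and ball volumes scale by 2^-m. The
    threshold in [iteration_step] thus shrinks by exactly this factor, and one [b] serves all
    steps. *)
Let theta : R := 2^-1 ^+ m.+1.

(** On the ball of radius r (1 + 2^-j) the overshoot above M (1 - 2^-j) has integral at most theta^j
    eps r^m M. The assumption r <= M ensures that each level increment is at least [dd]. *)
Lemma subminimal_bound :
  exists2 eps : R, 0 < eps &
    forall (o : T) (r M : R) (u : T -> R), 0 < r -> r <= M ->
      subminimal mu D m s Phi (nbh D o (2 * r)) u ->
      (\int[mu]_(x in nbh D o (2 * r)) (Num.max (u x) 0)%:E <=
        (eps * r ^+ m * M)%:E)%E ->
      \forall x \ae mu, nbh D o r x -> u x <= M.
Proof.
have cl0 := cl_gt0 reg.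
have t0 : 0 < theta by rewrite exprn_gt0.
have t1 : theta < 1 by rewrite exprn_ilt1// invf_lt1// ltr1n.
have thalf : theta <= 2^-1.
  by rewrite /theta exprS ler_piMr// exprn_ile1// invf_le1// ler1n.
have C0_ge0 : 0 <= 8 * M0 / (La * cl).
  by apply: divr_ge0; [exact: mulr_ge0|rewrite mulr_ge0// ltW].
have [b /andP[b0 b1] bt] := exists_small_powR C0_ge0 (introT andP (conj t0 t1)).
pose a := b / 4; have a0 : 0 < a by rewrite divr_gt0.
(* With dd = r h_j / 4 and k' - k = M h_j / 2, this value makes the smallness assumption of
   [iteration_step] an equality at every step. *)
pose eps := cl * a ^+ m / 4.
have eps0 : 0 < eps by rewrite !mulr_gt0 ?exprn_gt0.
exists eps => // o r M u r0 rM sub_u Y0.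
have M_gt0 : 0 < M := lt_le_trans r0 rM.
have Wu : Wspace mu D m s (nbh D o (2 * r)) u by case: sub_u.
have mu_u : measurable_fun setT u by case: Wu.
pose h j : R := 2^-1 ^+ j.
have h0 j : 0 < h j by rewrite exprn_gt0.
have h1 j : h j <= 1 by rewrite exprn_ile1// invf_le1// ler1n.
have hS j : h j.+1 = h j / 2 by rewrite /h exprS mulrC.
pose y j := theta ^+ j * (eps * r ^+ m * M).
have y0 j : 0 <= y j by rewrite mulr_ge0 ?exprn_ge0 ?mulr_ge0 ?exprn_ge0 ?ltW.
have R20 : 0 < 2 * r by rewrite mulr_gt0.
have step j : (\int[mu]_(x in nbh D o (r * (1 + h j)))
    (overshoot (M * (1 - h j)) (u x))%:E <= (y j)%:E)%E.
  elim: j => [|j IH].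
    have -> : r * (1 + h 0) = 2 * r by rewrite /h expr0; ring.
    have -> : M * (1 - h 0) = 0 by rewrite /h expr0 subrr mulr0.
    rewrite /y expr0 mul1r; apply: le_trans Y0.
    by under eq_integral do rewrite /overshoot subr0.
  pose dd := r * h j / 4.
  have dd0 : 0 < dd by rewrite !mulr_gt0.
  have rhoE : r * (1 + h j.+1) + 2 * dd = r * (1 + h j).
    by rewrite hS /dd; field.
  have kE : M * (1 - h j.+1) - M * (1 - h j) = M * h j / 2.
    by rewrite hS; field.
  apply: le_trans (iteration_step (R2 := 2 * r) (dd := dd)
    (k := M * (1 - h j)) (y := y j) (b := b) _ _ _ _ _ _ sub_u _ _) _ => //.
  - rewrite rhoE mulrC ler_pM2r//; have := h1 j; lra.
  - rewrite kE /dd; have := mulr_gt0 r0 (h0 j); have := ler_wpM2r (ltW (h0 j)) rM; lra.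
  - by rewrite b0.
  - by rewrite rhoE.
  - rewrite kE.
    have -> : b * dd = a * h j * r by rewrite /a /dd; field.
    have thE : theta ^+ j = h j ^+ m * h j.
      by rewrite /theta /h -exprM mulnC exprM -exprSr.
    rewrite /y thE /eps !exprMn le_eqVlt; apply/orP; left; apply/eqP; by field.
  have -> : y j.+1 = theta * y j by rewrite /y (exprS theta) -[LHS]mulrA.
  by rewrite lee_fin; exact: ler_wpM2r.
have mB := measurable_nbh reg o r.
have mw k := measurable_overshoot k mu_u.
have ov0 := @overshoot_ge0 R.
have := @integral_eq0_of_geometric _ _ _ mu (nbh D o r) (fun x => overshoot M (u x))
  (eps * r ^+ m * M) theta mB (measurable_funS measurableT (@subsetT _ _) (mw M))
  (fun x _ => ov0 M (u x)).
rewrite (ltW t0) thalf => /(_ isT) ae0.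
(* The radii decrease to [r] and the levels increase to [M], so every step bounds the integral of (u
   - M)_+ over the ball of radius [r]. *)
have {}ae0 : \forall x \ae mu, nbh D o r x -> overshoot M (u x) = 0.
  apply: ae0 => [|j]; first by rewrite mulr_ge0 ?mulr_ge0 ?exprn_ge0 ?ltW.
  apply: le_trans (step j).
  have mC := measurable_nbh reg o (r * (1 + h j)).
  have hj := h0 j.
  apply: (@le_trans _ _ (\int[mu]_(x in nbh D o r)
      (overshoot (M * (1 - h j)) (u x))%:E)%E).
    apply: ge0_le_integral_EFin => //.
    - exact: measurable_funS (mw _).
    - exact: measurable_funS (mw _).
    move=> x _; rewrite ov0 /=.
    rewrite /overshoot ge_max !le_max lexx orbT andbT; apply/orP; left.
    by have := mulr_ge0 (ltW M_gt0) (ltW hj); lra.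
  apply: ge0_subset_integral => //.
  - by apply/measurable_EFinP; exact: measurable_funS (mw _).
  - by move=> x _; rewrite lee_fin.
  - by move=> x; rewrite /nbh /= => xr; apply: lt_le_trans xr _; rewrite ler_peMr ?ltW// ltrDl.
apply: filterS ae0 => x H /H ov; rewrite leNgt; apply/negP => Mu.
move: ov; rewrite /overshoot => /eqP; apply/negP.
by rewrite gt_eqF// lt_max subr_gt0 Mu.
Qed.

End iteration.

(** * The Euclidean distance and Lebesgue measurability *)

Section euclidean.
Context {R : realType}.

(** The sum of the squares of B a_i - S b_i is nonnegative and equals B (A B - S^2). *)
Lemma sum_cauchy_schwarz n (a b : 'I_n -> R) :
  (\sum_i a i * b i) ^+ 2 <= (\sum_i a i ^+ 2) * (\sum_i b i ^+ 2).
Proof.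
set A := \sum_i a i ^+ 2; set B := \sum_i b i ^+ 2; set S := \sum_i _.
have B0 : 0 <= B by apply: sumr_ge0 => i _; exact: sqr_ge0.
have [B_eq0|Bn0] := eqVneq B 0.
  suff -> : S = 0 by rewrite B_eq0 mulr0 expr0n.
  apply: big1 => i _.
  have /psumr_eq0P : forall i, true -> 0 <= b i ^+ 2 by move=> j _; exact: sqr_ge0.
  by move=> /(_ B_eq0 i isT) /eqP; rewrite sqrf_eq0 => /eqP ->; rewrite mulr0.
have Bp : 0 < B by rewrite lt_def Bn0.
have : 0 <= \sum_i (B * a i - S * b i) ^+ 2.
  by apply: sumr_ge0 => i _; exact: sqr_ge0.
have -> : \sum_i (B * a i - S * b i) ^+ 2 = B * (A * B - S ^+ 2).
  have -> : \sum_i (B * a i - S * b i) ^+ 2 =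
      \sum_i (B ^+ 2 * a i ^+ 2 - 2 * B * S * (a i * b i) + S ^+ 2 * b i ^+ 2).
    by apply: eq_bigr => i _; ring.
  rewrite big_split /= sumrB -!mulr_sumr -/A -/B -/S; ring.
by rewrite pmulr_rge0// subr_ge0.
Qed.


Variable n : nat.
Implicit Types x y z : Rn R n.
Local Notation edist := (@Defs.edist R n).

Lemma edist_ge0 x y : 0 <= edist x y.
Proof. exact: sqrtr_ge0. Qed.

Lemma edist_sym x y : edist x y = edist y x.
Proof.
by rewrite /edist; congr Num.sqrt; apply: eq_bigr => i _; rewrite -sqrrN opprB.
Qed.

Lemma edist_eq0 x y : edist x y = 0 -> x = y.
Proof.
move=> /eqP; rewrite sqrtr_eq0 => le0; apply: eq_from_tnth => i.
have ge0 (j : 'I_n) : true -> 0 <= (tnth x j - tnth y j) ^+ 2.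
  by move=> _; exact: sqr_ge0.
have s0 : \sum_i (tnth x i - tnth y i) ^+ 2 = 0.
  by apply/eqP; rewrite eq_le le0 sumr_ge0.
have /eqP : (tnth x i - tnth y i) ^+ 2 = 0 := psumr_eq0P ge0 s0 isT.
by rewrite sqrf_eq0 subr_eq0 => /eqP.
Qed.

Lemma coord_le_edist x y i : `|tnth x i - tnth y i| <= edist x y.
Proof.
rewrite -sqrtr_sqr ler_wsqrtr// (bigD1 i)//= lerDl.
by apply: sumr_ge0 => j _; exact: sqr_ge0.
Qed.

Lemma edist_tri x y z : edist x z <= edist x y + edist y z.
Proof.
pose a i := tnth x i - tnth y i; pose b i := tnth y i - tnth z i.
pose A := \sum_i a i ^+ 2; pose B := \sum_i b i ^+ 2; pose S := \sum_i a i * b i.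
have A0 : 0 <= A by apply: sumr_ge0 => i _; exact: sqr_ge0.
have B0 : 0 <= B by apply: sumr_ge0 => i _; exact: sqr_ge0.
have SAB : S <= Num.sqrt A * Num.sqrt B.
  apply: le_trans (ler_norm _) _.
  by rewrite -sqrtr_sqr -sqrtrM// ler_wsqrtr// sum_cauchy_schwarz.
rewrite -[leRHS]ger0_norm ?addr_ge0 ?edist_ge0// -sqrtr_sqr ler_wsqrtr//.
rewrite sqrrD !sqr_sqrtr// -/A -/B.
have -> : \sum_(i < n) (tnth x i - tnth z i) ^+ 2 = A + S *+ 2 + B.
  rewrite /A /B /S -sumrMnl -!big_split; apply: eq_bigr => i _ /=.
  by rewrite /a /b; ring.
by rewrite lerD2r lerD2l lerMn2r.
Qed.

Lemma measurable_Rn (S : set (n.-tuple R)) :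
  measurable S -> measurable (S : set (Rn R n)).
Proof. by move=> mS; apply: sub_caratheodory; exact: sub_sigma_algebra. Qed.

Lemma leb_borel (S : set (n.-tuple R)) :
  measurable S -> leb R n S = borel_lebesgue n S.
Proof. by move=> mS; exact: measurable_mu_extE. Qed.

Lemma measurable_coord i : measurable_fun [set: Rn R n] (fun x => tnth x i).
Proof.
move=> _ Y mY; rewrite setTI; apply: measurable_Rn.
by rewrite -[X in measurable X]setTI; exact: measurable_tnth.
Qed.

Lemma measurable_edist :
  measurable_fun [set: Rn R n * Rn R n] (fun z : Rn R n * Rn R n => edist z.1 z.2).
Proof.
apply: measurableT_comp.
  by apply: continuous_measurable_fun; exact: sqrt_continuous.
apply: measurable_sum => i; apply: measurable_funX.
have m1 : measurable_fun [set: Rn R n * Rn R n]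
    (fun z : Rn R n * Rn R n => tnth z.1 i) :=
  measurableT_comp (measurable_coord i) measurable_fst.
have m2 : measurable_fun [set: Rn R n * Rn R n]
    (fun z : Rn R n * Rn R n => tnth z.2 i) :=
  measurableT_comp (measurable_coord i) measurable_snd.
exact: (measurable_funB m1 m2).
Qed.

End euclidean.

(** * Cubes and their measure *)

Section cube.
Context {R : realType}.

(** Balls of the maximum norm: their measure is computable from the product construction, and
    Euclidean balls are squeezed between them. *)
Definition cube n (x : n.-tuple R) (r : R) : set (n.-tuple R) :=
  [set y | forall i, tnth x i - r < tnth y i < tnth x i + r].

(** Splitting off the first coordinate follows the recursion that defines [borel_lebesgue]. *)
Lemma cubeS n (x : n.+1.-tuple R) r :
  cube x r = [set y | tnth x ord0 - r < tnth y ord0 < tnth x ord0 + r /\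
                      cube [tuple of behead x] r [tuple of behead y]].
Proof.
apply/seteqP; split => y /=.
  move=> H; split; first exact: H.
  move=> i; have := H (lift ord0 i); rewrite !tnth_behead.
  by rewrite (_ : inord i.+1 = lift ord0 i)//; apply/val_inj; rewrite /= inordK ?ltnS.
move=> [H0 H] i; have [->//|[j ->]] : i = ord0 \/ exists j, i = lift ord0 j.
  by case: (unliftP ord0 i) => [j|] ->; [right; exists j|left].
have := H j; rewrite !tnth_behead.
by rewrite (_ : inord j.+1 = lift ord0 j)//; apply/val_inj; rewrite /= inordK ?ltnS.
Qed.

Lemma measurable_cube n (x : n.-tuple R) r : measurable (cube x r).
Proof.
elim: n x => [|n IH] x.
  rewrite (_ : cube x r = setT)//; apply/seteqP; split => // y _ [].
  by [].
rewrite cubeS.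
pose f (y : n.+1.-tuple R) := (tnth y ord0, [tuple of behead y]).
have mf : measurable_fun setT f.
  apply/measurable_fun_pairP; split; first exact: measurable_tnth.
  exact: measurable_behead.
have mS : measurable (`]tnth x ord0 - r, tnth x ord0 + r[ `*` cube [tuple of behead x] r).
  by apply: measurableX; [exact: measurable_itv|exact: IH].
have := mf measurableT _ mS; rewrite setTI.
by congr measurable; apply/seteqP; split => y /=; rewrite in_itv.
Qed.

Lemma borel_lebesgue_cube n (x : n.-tuple R) r : 0 < r ->
  borel_lebesgue n (cube x r) = ((2 * r) ^+ n)%:E.
Proof.
move=> r0; elim: n x => [|n IH] x.
  rewrite expr0 /= diracE mem_set//.
  by case.
rewrite /= /lebesgue_step /pushforward.
have -> : @tcons R n @^-1` cube x r =
    `]tnth x ord0 - r, tnth x ord0 + r[ `*` cube [tuple of behead x] r.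
  rewrite cubeS; apply/seteqP; split => -[a t] /=.
    by rewrite in_itv/= => -[-> H]; split=> //; move: H; congr (cube _ _ _); apply: val_inj.
  rewrite in_itv/= => -[-> H]; split=> //; move: H; congr (cube _ _ _); exact: val_inj.
rewrite product_measure1E//; last exact: measurable_cube.
have side a : lebesgue_measure (`]a - r, a + r[%classic : set R) = (2 * r)%:E.
  rewrite lebesgue_measure_itv/= lte_fin ifT; last by rewrite ltrD2l; lra.
  by rewrite -EFinB; congr (_%:E); ring.
rewrite exprS EFinM; congr (_ * _)%E; [exact: side|exact: IH].
Qed.

End cube.

(** * Ahlfors regularity of R^n *)

Section regular_Rn.
Context {R : realType}.
Variable n : nat.
Local Notation edist := (@Defs.edist R n).

Lemma cube_sub_nbh (x : Rn R n) r : 0 < r ->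
  cube x (r / n.+1%:R) `<=` nbh edist x r.
Proof.
move=> r0 y /= Hy; rewrite /nbh /=.
have n0 : 0 < n.+1%:R :> R by rewrite ltr0n.
rewrite -[ltRHS](gtr0_norm r0) -sqrtr_sqr ltr_sqrt ?exprn_gt0//.
apply: (@le_lt_trans _ _ (\sum_(i < n) (r / n.+1%:R) ^+ 2)).
  have rn0 : 0 <= r / n.+1%:R := divr_ge0 (ltW r0) (ltW n0).
  apply: ler_sum => i _; rewrite -ler_sqrt ?exprn_ge0//.
  rewrite !sqrtr_sqr (ger0_norm rn0).
  move: (Hy i); set q := r / _ => /andP[h1 h2].
  by rewrite ler_norml; apply/andP; split; lra.
(* It remains to see n < (n+1)^2; dividing by n+1 avoids roots and a zero denominator. *)
rewrite sumr_const card_ord -[_ *+ n]mulr_natl expr_div_n mulrCA gtr_pMr ?exprn_gt0//.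
rewrite ltr_pdivrMr ?exprn_gt0// mul1r -natrX ltr_nat.
exact: leq_trans (ltnSn n) (leq_pmulr _ (ltn0Sn n)).
Qed.

Lemma nbh_sub_cube (x : Rn R n) r : nbh edist x r `<=` cube x r.
Proof.
move=> y; rewrite /nbh /= => yr i.
have := le_lt_trans (coord_le_edist y x i) yr.
rewrite ltr_norml => /andP[? ?]; apply/andP; split; lra.
Qed.

Lemma leb_cube (x : Rn R n) r : 0 < r -> leb R n (cube x r) = ((2 * r) ^+ n)%:E.
Proof.
by move=> r0; rewrite leb_borel ?borel_lebesgue_cube//; exact: measurable_cube.
Qed.

Lemma measurable_eball x r : measurable (nbh edist x r : set (Rn R n)).
Proof.
have mD : measurable_fun [set: Rn R n] (fun y => edist y x).
  exact: (measurable_fun_pair1 x (@measurable_edist R n)).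
have := measurable_fun_ltr mD (measurable_cst r).
by move=> /(_ measurableT [set true] I); rewrite setTI.
Qed.

Lemma regular_Rn :
  regular_space (leb R n) edist n ((2 / n.+1%:R) ^+ n) (2 ^+ n).
Proof.
split.
- exact: edist_ge0.
- exact: edist_sym.
- exact: edist_tri.
- exact: edist_eq0.
- exact: measurable_edist.
- by rewrite exprn_gt0.
- by rewrite exprn_gt0.
- move=> x r r0; have rn0 : 0 < r / n.+1%:R by rewrite divr_gt0.
  have -> : (2 / n.+1%:R) ^+ n * r ^+ n = (2 * (r / n.+1%:R)) ^+ n :> R.
    by rewrite -exprMn; congr (_ ^+ _); ring.
  rewrite -(leb_cube x rn0); apply: le_measure; rewrite ?inE.
  + by apply: measurable_Rn; exact: measurable_cube.
  + exact: measurable_eball.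
  + exact: cube_sub_nbh.
- move=> x r r0; rewrite -exprMn -(leb_cube x r0); apply: le_measure; rewrite ?inE.
  + exact: measurable_eball.
  + by apply: measurable_Rn; exact: measurable_cube.
  + exact: nbh_sub_cube.
Qed.

End regular_Rn.

(** * The local bound for subminimizers in R^n *)

Theorem proposition3p3 (R : realType) (n : nat) (s : R) (g : R -> R)
    (hn : (1 <= n)%N) (hs : 0 < s < 1)
    (g_range : forall t, 0 < g t <= 1)
    (g_even : forall t, g (- t) = g t)
    (g_cont : continuous g)
    (g_int : (\int[lebesgue_measure]_t (g t * `|t|)%:E < +oo)%E) :
  exists2 C : R, 0 < C &
    forall (r : R) (u : Rn R n -> R), 0 < r ->
      subminimizer s g (eball n (2 * r)) u ->
      (ess_sup_on (eball n r) (EFin \o u)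
       <= C%:E * (r%:E + (leb R n (eball n (2 * r)))^-1
                  * \int[leb R n]_(x in eball n (2 * r))
                      (Num.max (u x) 0)%:E))%E.
Proof.
have reg := regular_Rn (R := R) n.
have [eps eps0 bound] := subminimal_bound reg hs hn (slope_gt0 g_range g_cont g_int)
  (excess_ge0 g_range) (continuous_calG g_cont)
  (calG_lip g_range g_even g_cont g_int) (calG_le g_range g_even g_cont g_int)
  (calG_ge g_range g_even g_cont g_int).
have cu0 := cu_gt0 reg; have cl0 := cl_gt0 reg.
(* The ball of radius 2r has measure at most 2^n (2r)^n = 4^n r^n, which converts division by r^n
   into an average; [eps] is the smallness threshold, and 1 covers the summand r. *)
pose C := 1 + 2 ^+ n * 2 ^+ n / eps.
have q0 : 0 < 2 ^+ n * 2 ^+ n / eps by rewrite divr_gt0 ?mulr_gt0.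
exists C => [|r u r0 sub_u]; first by rewrite ltr_wpDl.
have r20 : 0 < 2 * r by rewrite mulr_gt0.
set V := leb R n _; set I := (\int[_]_(x in _) _)%E.
have Vge : (((2 / n.+1%:R) ^+ n * (2 * r) ^+ n)%:E <= V)%E := ball_ge reg _ r20.
have Vle : (V <= (2 ^+ n * (2 * r) ^+ n)%:E)%E := ball_le reg _ r20.
have I0 : (0 <= I)%E by apply: integral_ge0 => x _; rewrite lee_fin le_max lexx orbT.
have Wu : Wspace (leb R n) (@Defs.edist R n) n s (eball n (2 * r)) u by case: sub_u.
have mu_u : measurable_fun setT u by case: Wu.
have Ifin : I \is a fin_num.
  rewrite ge0_fin_numE//.
  have := overshoot_fin reg r20 Wu 0 (lexx (2 * r)).
  by rewrite /I; under eq_integral do rewrite /overshoot subr0.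
have Vfin : V \is a fin_num.
  rewrite ge0_fin_numE ?measure_ge0//; exact: le_lt_trans Vle (ltry _).
have Vp : 0 < fine V.
  rewrite -lte_fin fineK//; apply: lt_le_trans Vge; rewrite lte_fin.
  by rewrite mulr_gt0// exprn_gt0.
(* The first summand ensures r <= M, the second that the integral is at most eps r^n M. *)
pose M := r + fine I / (eps * r ^+ n).
have i0 : 0 <= fine I by rewrite fine_ge0.
have ern0 : 0 < eps * r ^+ n by rewrite mulr_gt0// exprn_gt0.
have rM : r <= M by rewrite lerDl divr_ge0// ltW.
have ae_le : \forall x \ae leb R n, nbh (@Defs.edist R n) (@origin R n) r x -> u x <= M.
  apply: (bound (@origin R n) r M u r0 rM sub_u).
  rewrite -[leLHS]/I -(fineK Ifin) lee_fin /M mulrDr mulrCA mulfV ?gt_eqF// mulr1.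
  by rewrite lerDr mulr_ge0 ?ltW.
apply: (@le_trans _ _ M%:E).
  (* Outside the ball the function in [ess_sup_on] is -oo, so only points of the ball matter. *)
  apply/ess_supP; apply: filterS ae_le => x Hx.
  by case: ifPn => [|_]; rewrite ?leNye// inE => /Hx; rewrite /= lee_fin.
rewrite -(fineK Ifin) -(fineK Vfin) inver gt_eqF// -!EFinM lee_fin.
have VE : fine V <= 2 ^+ n * 2 ^+ n * r ^+ n.
  by rewrite -lee_fin fineK// -mulrA -exprMn.
have h : fine I / (eps * r ^+ n) <= 2 ^+ n * 2 ^+ n / eps * ((fine V)^-1 * fine I).
  rewrite mulrA (mulrC (fine I)) ler_wpM2r//.
  rewrite ler_pdivlMr// ler_pdivrMl//.
  have -> : eps * r ^+ n * (2 ^+ n * 2 ^+ n / eps) = 2 ^+ n * 2 ^+ n * r ^+ n.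
    by field; rewrite gt_eqF.
  exact: VE.
have p : 0 <= (fine V)^-1 * fine I by rewrite mulr_ge0// invr_ge0 ltW.
rewrite /M /C; have := mulr_ge0 (ltW q0) (ltW r0); lra.
Qed.
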